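(* Let $T\subseteq[n]$. For each $(\omega,\epsilon)\in B_n$ let $\rho_{\omega,\epsilon}$ be the fundamental cycle of $\overline\Pi_{\omega,\epsilon}$, and for $(\omega,\epsilon)\in D_n$ let $\widetilde\rho_{\omega,\epsilon}$ be the fundamental cycle of $\overline{\widetilde\Pi}_{\omega,\epsilon}$. Then the set $\{\rho_{\omega,\epsilon}:(\omega,\epsilon)\in B_n,\ \omega(1)\in T$, all right-to-left maxima of $(\omega,\epsilon)$ unbarred$\}\ \cup\ \{\widetilde\rho_{\omega,\epsilon}:(\omega,\epsilon)\in D_n,\ \omega(1)\notin T\cup\{n\}$, all right-to-left maxima of $(\omega,\epsilon)$ unbarred$\}$ forms a basis for $\widetilde H_{n-2}(\overline{\Pi^{DB}_n(T)};\mathbb{Z})$.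
   Context: $B_n$ is the set of signed permutations $(\omega,\epsilon)$, $\omega\in S_n$, $\epsilon\in\{-1,1\}^n$, with $\omega(i)$ barred iff $\epsilon_i=-1$; $D_n\subseteq B_n$ consists of those with an even number of bars; $\epsilon'$ is $\epsilon$ with $\epsilon_1$ negated. $\omega(i)$ is a right-to-left maximum if $\omega(i)>\omega(j)$ for all $j>i$. Signed partitions: partitions of $\{0,\dots,n\}$ in which nonminimal elements of nonzero blocks (blocks not containing $0$) may be barred; the zero block has no bars. $\bar b$ toggles all bars of a block $b$, $\widetilde b$ removes them. $\Pi^B_n$ is ordered by $\pi\le\tau$ iff for each block $b$ of $\pi$, $b$ or $\bar b$ lies (as signed letters) in a nonzero block of $\tau$, or $\widetilde b$ lies in the zero block of $\tau$. $\Pi^D_n$ is the subposet of signed partitions whose zero block does not have size 2. $\Pi^{DB}_n(T)$ is the subposet of $\Pi^B_n$ of signed partitions whose zero block is not $\{0,a\}$ for any $a\in[n]\setminus T$ (it is the intersection lattice of the arrangement $\{x_i=\pm x_j\}_{i<j}\cup\{x_i=0\}_{i\in T}$). Bars over a poset with bottom and top denote its proper part; homology is that of the order complex. Splitting $(\omega,\epsilon)$ at positions $i_1<\dots<i_k$ in $\{0,\dots,n-1\}$ ($i_{k+1}=n$; $k=0$ gives the one-block partition): zero block $\{0,\omega(1),\dots,\omega(i_1)\}$ and for $j=1,\dots,k$ the nonzero block equal to whichever of $b_j=\{(\omega(i_j+1),\epsilon_{i_j+1}),\dots,(\omega(i_{j+1}),\epsilon_{i_{j+1}})\}$ or $\bar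 b_j$ has unbarred minimal element ($(a,-1)=\bar a$, $(a,1)=a$). $\Pi_{\omega,\epsilon}$ is the induced subposet of $\Pi^B_n$ of all signed partitions obtained by splitting $(\omega,\epsilon)$ at any set of positions; $\widetilde\Pi_{\omega,\epsilon}$ (for $(\omega,\epsilon)\in D_n$) is the induced subposet of $\Pi^D_n$ of all signed partitions obtained by splitting $(\omega,\epsilon)$ or $(\omega,\epsilon')$ at all positions of a subset of $\{0,\dots,n-1\}$ whose smallest element is not $1$. Both are Boolean lattices, so their proper parts $\overline\Pi_{\omega,\epsilon}$, $\overline{\widetilde\Pi}_{\omega,\epsilon}$ have order complexes that are $(n-2)$-spheres; the fundamental cycles are defined up to sign.
   Formalization: The case n = 1 with T empty is excluded: there the poset is a single point, its proper part is empty with reduced homology Z in degree -1, while the proposed basis is empty, so the claim fails. *)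

(* Defs.v *)
From mathcomp Require Import all_boot all_order all_algebra all_fingroup.

Set Implicit Arguments.
Unset Strict Implicit.
Unset Printing Implicit Defensive.

Import GRing.Theory.
Local Open Scope ring_scope.

(** * Reduced simplicial homology of order complexes *)

Section OrderHomology.

Variables (V : finType) (le : rel V).

(* P minus its least and its greatest element. *)
Definition proper_part (P : {set V}) : {set V} :=
  [set x in P | ~~ [forall y in P, le x y] && ~~ [forall y in P, le y x]].

(* The empty set is a simplex, of dimension -1: the chain complex below is the
   augmented one, so that its homology is reduced homology. *)
Definition simplex (P : {set V}) (d : int) (C : {set V}) : bool :=
  [&& C \subset P, [forall x in C, forall y in C, le x y || le y x]
    & #|C|%:Z == d + 1].

(* Integral chains are formal combinations of sets of vertices; those of
   degree d of the order complex of P are supported on its d-simplices. *)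
Definition ochain := {ffun {set V} -> int}.

Definition dchain (P : {set V}) (d : int) (c : ochain) : Prop :=
  forall C, c C != 0 -> simplex P d C.

(* Vertices of a simplex are listed increasingly, so that the face opposite to
   x gets the sign (-1)^i, with i the number of vertices below x. *)
Definition boundary (c : ochain) : ochain :=
  [ffun D : {set V} => \sum_(C : {set V}) \sum_(x in C | C :\ x == D)
     (-1) ^+ #|[set y in C | (y != x) && le y x]| * c C].

Definition is_cycle (P : {set V}) (d : int) (c : ochain) : Prop :=
  dchain P d c /\ boundary c = 0.

Definition is_boundary (P : {set V}) (d : int) (c : ochain) : Prop :=
  exists2 b, dchain P (d + 1) b & c = boundary b.

(* The z i are d-cycles, and their classes form a basis of the abelian group
   (d-cycles)/(d-boundaries), the d-th reduced homology of the order complex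
   of P. *)
Definition homology_basis (P : {set V}) (d : int) (I : finType)
    (z : I -> ochain) : Prop :=
  [/\ forall i, is_cycle P d (z i),
      forall c, is_cycle P d c ->
        exists a : I -> int, is_boundary P d (c - \sum_i z i *~ a i)
    & forall a : I -> int, is_boundary P d (\sum_i z i *~ a i) ->
        forall i, a i = 0].

(* For a d-sphere: a cycle whose class generates the infinite cyclic group of
   degree d; when the order complex of P has dimension d, it is unique up to
   sign. *)
Definition fundamental_cycle (P : {set V}) (d : int) (z : ochain) : Prop :=
  homology_basis P d (fun _ : unit => z).

End OrderHomology.

(** * Signed partitions *)

Section SignedPartitions.

Variable n : nat.

(* An element of {0, ..., n} with a flag telling whether it is barred. *)
Definition sletter := ('I_n.+1 * bool)%type.

Definition zero_letter : sletter := (ord0, false).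

(* The set [n] is represented by 'I_n, with a : 'I_n standing for a + 1. *)
Definition letter (a : 'I_n) (barred : bool) : sletter := (lift ord0 a, barred).

Definition bar (b : {set sletter}) : {set sletter} :=
  [set (x.1, ~~ x.2) | x in b].

Definition unbar (b : {set sletter}) : {set sletter} :=
  [set (x.1, false) | x in b].

Definition min_unbarred (b : {set sletter}) : bool :=
  [forall x in b, [forall y in b, (x.1 <= y.1)%N] ==> ~~ x.2].

Definition blocks := {set {set sletter}}.

(* Each element of {0, ..., n} occurs in exactly one block, with exactly one of
   its two possible signs. *)
Definition signed_partition (p : blocks) : bool :=
  [&& partition p (cover p),
      [forall a : 'I_n.+1, ((a, false) \in cover p) != ((a, true) \in cover p)],
      [forall b in p, min_unbarred b]
    & [forall b in p, (zero_letter \in b) ==> [forall x in b, ~~ x.2]]].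

Definition sple (p t : blocks) : bool :=
  [forall b in p, exists c in t,
     if zero_letter \in c then unbar b \subset c
     else (b \subset c) || (bar b \subset c)].

Definition PiB : {set blocks} := [set p | signed_partition p].

Definition PiD : {set blocks} :=
  [set p in PiB | [forall b in p, (zero_letter \in b) ==> (#|b| != 2)%N]].

Definition PiDB (T : {set 'I_n}) : {set blocks} :=
  [set p in PiB |
    [forall a : 'I_n, (a \notin T) ==>
       ([set zero_letter; letter a false] \notin p)]].

(** * Signed permutations *)

(* u.1 is the permutation (of 'I_n, so that positions and values are both
   shifted by one) and u.2 i tells whether its value at i is barred. *)
Definition sperm := ('S_n * {ffun 'I_n -> bool})%type.

Definition in_D (u : sperm) : bool := ~~ odd #|[set i | u.2 i]|.

Definition flip_first (u : sperm) : sperm :=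
  (u.1, [ffun i : 'I_n => u.2 i (+) (i == 0 :> nat)%N]).

Definition rl_max (u : sperm) (i : 'I_n) : bool :=
  [forall j : 'I_n, (i < j)%N ==> (u.1 j < u.1 i)%N].

Definition rl_max_unbarred (u : sperm) : bool :=
  [forall i, rl_max u i ==> ~~ u.2 i].

Definition normalize (b : {set sletter}) : {set sletter} :=
  if min_unbarred b then b else bar b.

(* Splitting at S, a set of positions in {0, ..., n-1}: because of the shift,
   cutting at position s is cutting just before the index s : 'I_n. *)
Definition split_zero (u : sperm) (S : {set 'I_n}) : {set sletter} :=
  zero_letter |:
    [set letter (u.1 p) false | p : 'I_n & [forall s in S, (p < s)%N]].

Definition split_block (u : sperm) (S : {set 'I_n}) (s : 'I_n) :
    {set sletter} :=
  [set letter (u.1 p) (u.2 p) | p : 'I_n &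
     (s <= p)%N && [forall t in S, (t <= p)%N ==> (t <= s)%N]].

Definition split_at (u : sperm) (S : {set 'I_n}) : blocks :=
  split_zero u S |: [set normalize (split_block u S s) | s in S].

Definition min_not_one (S : {set 'I_n}) : bool :=
  [forall i in S, [forall j in S, (i <= j)%N] ==> (i != 1 :> nat)%N].

Definition Pi_sp (u : sperm) : {set blocks} :=
  [set p in PiB | [exists S : {set 'I_n}, p == split_at u S]].

Definition tPi_sp (u : sperm) : {set blocks} :=
  [set p in PiD | [exists S : {set 'I_n}, min_not_one S &&
     ((p == split_at u S) || (p == split_at (flip_first u) S))]].

(* The two index sets; "first value" is the value at index 0, and the letter n
   is the a : 'I_n with a + 1 = n. *)
Definition basisB (T : {set 'I_n}) (u : sperm) : bool :=
  [exists i : 'I_n, (i == 0 :> nat)%N && (u.1 i \in T)] && rl_max_unbarred u.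

Definition basisD (T : {set 'I_n}) (u : sperm) : bool :=
  [&& in_D u,
      [exists i : 'I_n, [&& (i == 0 :> nat)%N, u.1 i \notin T
                          & (u.1 i).+1 != n]]
    & rl_max_unbarred u].

End SignedPartitions.

(* Main.v *)
Require Import Defs.
From HB Require Import structures.
From mathcomp Require Import all_boot all_order all_algebra all_fingroup zify.

Set Implicit Arguments.
Unset Strict Implicit.
Unset Printing Implicit Defensive.

Import GRing.Theory.

(**
Since the order complex has dimension [n - 2], homology classes are cycles, and
it suffices to find one facet [fchain u] per index [u] such that the values of
the given cycles on these facets form a unitriangular matrix, while a cycle
that vanishes on all of them is zero.

Cut the word of [u] after each right-to-left maximum.  [fchain u] starts from
the bottom and lets the greatest nonzero letter absorb, one at a time, the
letters that precede it in its group, then sends the group to the zero block,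
and goes on with the next group.  If [fchain u] lies in the Boolean lattice of
[u'], then the suffix maxima of [u'] are at most those of [u], with equality
only if [u] and [u'] agree, up to the first sign in the case of type D.

A facet is critical if each of its steps changes the block of the greatest
nonzero letter; the critical facets are the chains [fchain u] with unbarred
right-to-left maxima.  Record at each step of a facet 2 if this letter enters
the zero block, 1 if its block grows, and 0 otherwise.  At a noncritical facet
one element can be exchanged so that every other facet through the remaining
face has a lexicographically greater record, so a cycle is determined by its
values on critical facets.  The critical facets outside the index set are
those of [u] with [u(1)] not in [T] and an odd number of bars; exchanging the
element in which the whole first group is a nonzero block gives facets with a
greater record, and the facet of [u] with its first sign flipped, which is
indexed.
*)

(** * Signed partitions as signed equivalence relations *)

(** Signs are stored normalized block by block and [sple] allows a bar on each block, so a direct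
    comparison must track bars. The relation [srel] on all letters removes this: the order becomes
    inclusion, and a splitting becomes the relation generated by its uncut adjacencies. Passing from
    [PiB] to a subposet only removes facets, so the elimination at noncritical facets is insensitive
    to T. What T changes is the first group when u(1) is outside T. If that group were a single
    letter, the facet would contain the excluded zero block {0, u(1)}; hence u(1) is not n in type
    D. Otherwise, take the rank two interval from the element where u(1) is alone beside the rest of
    its group to the one where both are zero. In [PiB] it has four middle elements: the rest goes to
    zero, the two are joined with either relative sign, or u(1) alone goes to zero. The last is
    excluded, so the two joined ones are tied, and one parity of bars suffices. The triangular order
    is by the sum [hgt] of suffix maxima. In type D the comparison cannot see the first sign, which
    parity restores. *)

Section Srel.
Variable n : nat.
Implicit Types (p t : blocks n) (b : {set sletter n}) (x y z : sletter n).

Definition sbar x : sletter n := (x.1, ~~ x.2).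
Definition lsign p (a : 'I_n.+1) : bool := (a, true) \in cover p.
Definition lblock p (a : 'I_n.+1) := pblock p (a, lsign p a).

(** Its classes are the nonzero blocks, their bars, and one class made of the zero block and its
    bar. Both signs of every letter take part, whichever one is stored in [p]. *)
Definition srel p : rel (sletter n) := fun x y =>
  (lblock p x.1 == lblock p y.1) &&
  ((zero_letter n \in lblock p x.1) ||
   (x.2 (+) lsign p x.1 == y.2 (+) lsign p y.1)).

Lemma srel_refl p x : srel p x x.
Proof. by rewrite /srel !eqxx orbT. Qed.

Lemma srel_sym p x y : srel p x y = srel p y x.
Proof.
rewrite /srel eq_sym; case: eqP => //= ->.
by rewrite [_.2 (+) _ == _]eq_sym.
Qed.

Lemma srel_trans p y x z : srel p x y -> srel p y z -> srel p x z.
Proof.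
rewrite /srel => /andP[/eqP-> Hxy] /andP[/eqP Eyz Hyz]; rewrite Eyz eqxx /=.
move: Hxy Hyz; rewrite Eyz; case: (_ \in _) => //= /eqP-> /eqP->.
by rewrite eqxx.
Qed.

Lemma sbarK x : sbar (sbar x) = x.
Proof. by case: x => a s; rewrite /sbar /= negbK. Qed.

Lemma srel_bar p x y : srel p (sbar x) (sbar y) = srel p x y.
Proof. by rewrite /srel /= !addNb (inj_eq negb_inj). Qed.

Lemma srel_barC p x y : srel p (sbar x) y = srel p x (sbar y).
Proof. by rewrite -{1}[y]sbarK srel_bar. Qed.

Lemma PiB_cover p a : p \in PiB n -> ((a, false) \in cover p) = ~~ lsign p a.
Proof.
rewrite inE => /and4P[_ /forallP/(_ a) + _ _]; rewrite /lsign.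
by do 2!case: (_ \in _).
Qed.

Lemma mem_cover_sign p a : p \in PiB n -> (a, lsign p a) \in cover p.
Proof.
move=> pP; case E: (lsign p a); first by [].
by rewrite (PiB_cover _ pP) E.
Qed.

Lemma cover_signE p x : p \in PiB n -> x \in cover p -> x.2 = lsign p x.1.
Proof.
case: x => a [] pP xp /=; first by rewrite /lsign xp.
by move: xp; rewrite (PiB_cover _ pP); case: lsign.
Qed.

Lemma lblock_in p a : p \in PiB n -> lblock p a \in p.
Proof. by move=> pP; apply: pblock_mem; exact: mem_cover_sign. Qed.

Lemma mem_lblock p a : p \in PiB n -> (a, lsign p a) \in lblock p a.
Proof. by move=> pP; rewrite mem_pblock; exact: mem_cover_sign. Qed.

Lemma lblock_eq p b x : p \in PiB n -> b \in p -> x \in b ->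
  lblock p x.1 = b /\ x.2 = lsign p x.1.
Proof.
move=> pP bp xb.
have xc : x \in cover p by apply/bigcupP; exists b.
have sx := cover_signE pP xc; split=> //.
rewrite /lblock -sx -surjective_pairing; apply: def_pblock => //.
by move: pP; rewrite inE => /and4P[/and3P[_ ? _] _ _ _].
Qed.

Lemma in_lblock p a x : p \in PiB n ->
  (x \in lblock p a) = (lblock p x.1 == lblock p a) && (x.2 == lsign p x.1).
Proof.
move=> pP; apply/idP/andP=> [xb|[/eqP<- /eqP E]].
  by have [-> ->] := lblock_eq pP (lblock_in a pP) xb; rewrite !eqxx.
by rewrite [x in x \in _]surjective_pairing E mem_lblock.
Qed.

Lemma lsign0 p : p \in PiB n -> lsign p ord0 = false.
Proof.
move=> pP; have := lblock_in ord0 pP; have := mem_lblock ord0 pP.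
case: (lsign p ord0) => // H1 H2; move: (pP); rewrite inE => /and4P[_ _ /forall_inP H _].
have /forall_inP/(_ _ H1) := H _ H2.
move/implyP=> h; suff: ~~ (ord0 : 'I_n.+1, true).2 by []; apply: h.
by apply/forall_inP.
Qed.

Lemma zero_lblock p a : p \in PiB n ->
  (zero_letter n \in lblock p a) = (lblock p a == lblock p ord0).
Proof.
move=> pP; rewrite in_lblock //= lsign0 // eqxx andbT eq_sym.
by [].
Qed.

Lemma zero_sign p a : p \in PiB n -> zero_letter n \in lblock p a ->
  lsign p a = false.
Proof.
move=> pP za; move: (pP); rewrite inE => /and4P[_ _ _ /forall_inP H].
have /implyP/(_ za)/forall_inP/(_ _ (mem_lblock a pP)) := H _ (lblock_in a pP).
by move/negbTE.
Qed.

Lemma srel_bar_zero p x : p \in PiB n ->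
  srel p x (sbar x) -> srel p x (zero_letter n).
Proof.
move=> pP; rewrite /srel /= eqxx /=; case: x => a s /=.
rewrite addNb [_ (+) _ == _]eq_sym; case z: (_ \in _) => /=.
  by rewrite -zero_lblock // z.
by case: (s (+) _).
Qed.

Lemma srel0_sign p x : p \in PiB n ->
  srel p x (zero_letter n) = (lblock p x.1 == lblock p ord0).
Proof.
move=> pP; rewrite /srel /= zero_lblock //.
by case: eqP.
Qed.

Lemma srel_zero_bar p x : p \in PiB n ->
  srel p (sbar x) (zero_letter n) = srel p x (zero_letter n).
Proof. by move=> pP; rewrite !srel0_sign. Qed.

(** Fitting a block into a nonzero block of [t] up to one global bar means preserving relative
    signs, and the zero block forgets signs; [srel] records exactly this. *)
Lemma spleP p t : p \in PiB n -> t \in PiB n ->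
  reflect (forall x y, srel p x y -> srel t x y) (sple p t).
Proof.
move=> pP tP; apply: (iffP idP) => [/forall_inP H x y|H]; last first.
  apply/forall_inP=> b bp.
  have [x xb] : exists x, x \in b.
    move: (pP); rewrite inE => /and4P[/and3P[_ _ s0] _ _ _].
    by apply/set0Pn; apply: contraNneq s0 => <-.
  have [bx sx] := lblock_eq pP bp xb.
  have R y : y \in b -> srel t y x.
    move=> yb; have [by_ sy] := lblock_eq pP bp yb.
    by apply: H; rewrite /srel bx by_ eqxx -sx -sy !addbb eqxx orbT.
  apply/exists_inP; exists (lblock t x.1); first exact: lblock_in.
  case: ifP => z.
    apply/subsetP=> _ /imsetP[y yb ->]; rewrite in_lblock //=.
    have /andP[E _] := R _ yb; rewrite E /= zero_sign //.
    by rewrite (eqP E).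
  case e: (x.2 (+) lsign t x.1); apply/orP; [right|left]; apply/subsetP=> y.
    case/imsetP=> w wb ->; rewrite in_lblock //=.
    move: (R _ wb); rewrite /srel => /andP[E]; rewrite E (eqP E) z /= e.
    by case: w.2; case: lsign.
  move=> wb; rewrite in_lblock //=.
  move: (R _ wb); rewrite /srel => /andP[E]; rewrite E (eqP E) z /= e.
  by case: y.2; case: lsign.
case/andP=> /eqP Exy Hs.
have bp := lblock_in x.1 pP.
have /exists_inP[c ct] := H _ bp.
have xb := mem_lblock x.1 pP.
have yb : (y.1, lsign p y.1) \in lblock p x.1 by rewrite Exy mem_lblock.
case: ifP => z.
  move=> /subsetP sub.
  have [] := lblock_eq tP ct (sub _ (imset_f _ xb)).
  have [] := lblock_eq tP ct (sub _ (imset_f _ yb)) => /= ey _ ex _.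
  by rewrite /srel ex ey eqxx z.
have nz : zero_letter n \notin lblock p x.1 ->
   forall f, (forall w, w \in lblock p x.1 -> (w.1, w.2 (+) f) \in c) -> srel t x y.
  move=> nz f Hf.
  have [] := lblock_eq tP ct (Hf _ xb).
  have [] := lblock_eq tP ct (Hf _ yb) => /= ey sy ex sx.
  move: Hs; rewrite /srel ex ey eqxx z (negbTE nz) /= -sx -sy !addbA => /eqP->.
  by rewrite eqxx.
(* A block with 0 cannot fit into a block [c] without the unbarred 0: [c] would then contain the
   barred 0, which no signed partition has. *)
have Z f : (forall w, w \in lblock p x.1 -> (w.1, w.2 (+) f) \in c) -> 
  zero_letter n \notin lblock p x.1.
  move=> Hf; apply/negP=> z0; have := Hf _ z0 => /=; case: f {Hf} => /= zc; last by rewrite zc in z.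
  have [_ /=] := lblock_eq tP ct zc; by rewrite lsign0.
case/orP=> /subsetP sub.
  have Hf w : w \in lblock p x.1 -> (w.1, w.2 (+) false) \in c.
    by rewrite addbF -surjective_pairing; exact: sub.
  exact: (nz (Z _ Hf) _ Hf).
have Hf w : w \in lblock p x.1 -> (w.1, w.2 (+) true) \in c.
  by rewrite addbT => H1; apply: sub; apply/imsetP; exists w.
exact: (nz (Z _ Hf) _ Hf).
Qed.

Lemma sple_refl p : p \in PiB n -> sple p p.
Proof. by move=> pP; apply/spleP. Qed.

(** The classes fix a nonzero block only up to a global bar [f]; its least element is unbarred in
    both partitions, so [f] is trivial. *)
Lemma srel_lblock p t a : p \in PiB n -> t \in PiB n -> srel p =2 srel t ->
  lblock p a = lblock t a.
Proof.
move=> pP tP E.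
have L c : (lblock p c == lblock p a) = (lblock t c == lblock t a).
  have F (q : blocks n) : (lblock q c == lblock q a) =
      srel q (c, false) (a, false) || srel q (c, false) (a, true).
    rewrite /srel /=; case: eqP => //= _; case: (_ \in _) => //=.
    by do 2!case: lsign.
  by rewrite !F !E.
have Z : (zero_letter n \in lblock p a) = (zero_letter n \in lblock t a).
  by rewrite !zero_lblock // -(srel0_sign (a, false) pP) E srel0_sign.
have [z|z] := boolP (zero_letter n \in lblock p a).
  apply/setP=> x; rewrite !in_lblock // L; case: eqP => //= Ex.
  have zt : zero_letter n \in lblock t x.1 by rewrite Ex -Z.
  have zp : zero_letter n \in lblock p x.1.
    by move/eqP: Ex; rewrite -L => /eqP->.
  by rewrite !zero_sign.
have [f Hf] : exists f, forall c, lblock p c = lblock p a ->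
    lsign p c = lsign t c (+) f.
  exists (lsign p a (+) lsign t a) => c Ec.
  have: srel p (c, lsign p c) (a, lsign p a) by rewrite /srel Ec /= eqxx !addbb orbT.
  rewrite E /srel /= => /andP[/eqP->]; rewrite -Z (negbTE z) /= => /eqP.
  by do 4!case: lsign.
have min0 (q : blocks n) c : q \in PiB n -> lblock q c = lblock q a ->
   (forall c', lblock q c' = lblock q a -> (c <= c')%N) -> lsign q c = false.
  move=> qP Ec Hc; move: (qP); rewrite inE => /and4P[_ _ /forall_inP H _].
  have /forall_inP/(_ _ (mem_lblock c qP))/implyP := H _ (lblock_in c qP).
  move=> /= h; apply/negbTE/h/forall_inP=> y yc; apply: Hc.
  by rewrite -Ec; have [] := lblock_eq qP (lblock_in c qP) yc.
have [c /eqP cP cmin] := @arg_minnP _ a (fun c => lblock p c == lblock p a) (fun c => c : nat) (eqxx _).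
have s0 : lsign p c = false by apply: min0 => // c' /eqP; exact: cmin.
have t0 : lsign t c = false.
  apply: min0 => //; first by apply/eqP; rewrite -L cP.
  by move=> c' /eqP; rewrite -L; exact: cmin.
have f0 : f = false by move: (Hf _ cP); rewrite s0 t0; case: (f).
apply/setP=> x; rewrite !in_lblock // -L; case: eqP => //= Ex.
by rewrite (Hf _ Ex) f0 addbF.
Qed.

Lemma srel_inj p t : p \in PiB n -> t \in PiB n -> srel p =2 srel t -> p = t.
Proof.
suff W : forall p t, p \in PiB n -> t \in PiB n -> srel p =2 srel t -> p \subset t.
  move=> pP tP E; apply/eqP; by rewrite eqEsubset !W.
move=> {}p {}t pP tP E; apply/subsetP=> b bp.
have [x xb] : exists x, x \in b.
  move: (pP); rewrite inE => /and4P[/and3P[_ _ s0] _ _ _].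
  by apply/set0Pn; apply: contraNneq s0 => <-.
have [<- _] := lblock_eq pP bp xb.
by rewrite (srel_lblock _ pP tP E) lblock_in.
Qed.

Lemma sple_anti p t : p \in PiB n -> t \in PiB n -> sple p t -> sple t p -> p = t.
Proof.
move=> pP tP /spleP H1 /spleP H2; apply: srel_inj => // x y.
by apply/idP/idP; [exact: H1|exact: H2].
Qed.

Lemma zero_blockP p a : p \in PiB n ->
  (forall c, srel p (c, false) (zero_letter n) = (c == ord0) || (c == lift ord0 a)) ->
  [set zero_letter n; letter a false] \in p.
Proof.
move=> pP H.
have <- : lblock p ord0 = [set zero_letter n; letter a false].
  apply/setP=> -[c s]; rewrite in_lblock // !inE /= -(srel0_sign (c, false)) // H.
  rewrite /zero_letter /letter !xpair_eqE.
  have: ((c == ord0) || (c == lift ord0 a)) -> lsign p c = false.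
    by rewrite -H srel0_sign // -zero_lblock // => /(zero_sign pP).
  by rewrite -andb_orl; case: (_ || _) => //= ->.
exact: lblock_in.
Qed.

Lemma zero_block_srel p a : p \in PiB n -> [set zero_letter n; letter a false] \in p ->
  forall c, srel p (c, false) (zero_letter n) = (c == ord0) || (c == lift ord0 a).
Proof.
move=> pP bp c; have zb : zero_letter n \in [set zero_letter n; letter a false] by rewrite !inE eqxx.
have [E _] := lblock_eq pP bp zb.
rewrite srel0_sign //= E; apply/eqP/orP => [Ec|].
  have := mem_lblock c pP; rewrite Ec !inE !xpair_eqE /= => /orP[]/andP[-> _]; by [left|right].
case=> /eqP->; first by rewrite -E.
have ab : letter a false \in [set zero_letter n; letter a false] by rewrite !inE eqxx orbT.
by have [] := lblock_eq pP bp ab.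
Qed.

End Srel.

(** * Splittings of a signed permutation *)

Section Split.
Variable n : nat.
Implicit Types (u : sperm n) (S : {set 'I_n}) (t : blocks n).

Lemma min_unbarred_normalize (b : {set sletter n}) :
  {in b &, injective (fun x : sletter n => x.1)} -> min_unbarred (normalize b).
Proof.
move=> inj; rewrite /normalize; case: ifP => //.
move/forall_inPn=> [x xb]; rewrite negb_imply negbK => /andP[/forall_inP xmin x2].
apply/forall_inP=> _ /imsetP[y yb ->] /=; apply/implyP=> /forall_inP ymin.
suff -> : y = x by rewrite x2.
apply: inj => //; apply/val_inj/eqP; rewrite eqn_leq xmin // andbT.
by apply: (ymin (x.1, ~~ x.2)); apply/imsetP; exists x.
Qed.

Lemma mem_normalize (b : {set sletter n}) x :
  (x \in normalize b) = ((x.1, x.2 (+) ~~ min_unbarred b) \in b).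
Proof.
rewrite /normalize; case: ifP => _ /=; first by rewrite addbF -surjective_pairing.
rewrite addbT; apply/imsetP/idP => [[y yb ->] /=|xb].
  by rewrite negbK -surjective_pairing.
by exists (x.1, ~~ x.2) => //=; rewrite negbK -surjective_pairing.
Qed.

(** [cuts S p.+1] numbers the block that contains position p, with 0 for the zero block. *)
Definition cuts S (k : nat) := #|[set s in S | (s < k)%N]|.

Lemma cuts_mono S j k : (j <= k)%N -> (cuts S j <= cuts S k)%N.
Proof.
move=> jk; apply/subset_leq_card/subsetP=> s; rewrite !inE => /andP[-> /=] h.
exact: leq_trans jk.
Qed.

Lemma cuts_eqP S j k : (j <= k)%N ->
  reflect (forall s, s \in S -> (j <= s)%N -> (k <= s)%N) (cuts S j == cuts S k).
Proof.
move=> jk.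
have sub : [set s in S | (s < j)%N] \subset [set s in S | (s < k)%N].
  by apply/subsetP=> s; rewrite !inE => /andP[-> /=] h; exact: leq_trans jk.
rewrite /cuts (subset_leqif_cards sub).2.
apply: (iffP eqP) => [E s sS js|H].
  rewrite leqNgt; apply/negP=> sk.
  by have := in_set (fun s : 'I_n => (s \in S) && (s < k)%N) s; rewrite -E inE sS sk /= ltnNge js.
apply/setP=> s; rewrite !inE; case sS: (s \in S) => //=.
apply/idP/idP => [sj|sk]; first exact: leq_trans jk.
by rewrite ltnNge; apply: contraL sk => js; rewrite -leqNgt H.
Qed.

Lemma cuts0 S k : reflect (forall s, s \in S -> (k <= s)%N) (cuts S k == 0%N).
Proof.
rewrite /cuts cards_eq0; apply: (iffP eqP) => [E s sS|H].
  by rewrite leqNgt; apply/negP=> sk; have := in_set0 s; rewrite -E inE sS sk.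
by apply/setP=> s; rewrite !inE; apply/negP=> /andP[/H]; rewrite leqNgt => /negP.
Qed.

Lemma in_split_zero u S x : (x \in split_zero u S) =
  (x == zero_letter n) || [exists p : 'I_n, (x == letter (u.1 p) false) && (cuts S p.+1 == 0%N)].
Proof.
rewrite !inE; congr (_ || _); apply/imsetP/existsP => [[p]|[p /andP[/eqP-> /cuts0 H]]].
  rewrite inE => /forall_inP H ->; exists p; rewrite eqxx; apply/cuts0 => s; exact: H.
by exists p => //; rewrite inE; apply/forall_inP.
Qed.

Lemma in_split_block u S s x : s \in S -> (x \in split_block u S s) =
  [exists p : 'I_n, [&& x == letter (u.1 p) (u.2 p), (s <= p)%N & cuts S p.+1 == cuts S s.+1]].
Proof.
move=> sS; apply/imsetP/existsP => [[p]|[p /and3P[/eqP-> sp]]].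
  rewrite inE => /andP[sp /forall_inP H ->]; exists p; rewrite eqxx sp eq_sym /=.
  apply/cuts_eqP => // t tS st; rewrite ltnNge; apply/negP=> tp.
  by have := implyP (H t tS) tp; rewrite leqNgt st.
rewrite eq_sym => /cuts_eqP H; exists p => //; rewrite inE sp /=.
apply/forall_inP=> t tS; apply/implyP=> tp; rewrite leqNgt; apply/negP=> st.
by have := H sp t tS st; rewrite ltnNge tp.
Qed.

Lemma letter_inj (a b : 'I_n) s s' : letter a s = letter b s' -> a = b /\ s = s'.
Proof. by case=> E ->; split=> //; apply/ord_inj. Qed.

Lemma last_cut S (p : 'I_n) : (cuts S p.+1 != 0)%N ->
  exists s, [/\ s \in S, (s <= p)%N & cuts S p.+1 = cuts S s.+1].
Proof.
move=> c0; have [s0 s0P] : exists s, s \in [set s in S | (s < p.+1)%N].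
  by apply/set0Pn; rewrite -cards_eq0.
have [s] := @arg_maxnP _ s0 (fun s => s \in [set s in S | (s < p.+1)%N]) (fun s => val s) s0P.
rewrite inE => /andP[sS sp] smax; exists s; split=> //; apply/eqP; rewrite eq_sym.
apply/cuts_eqP=> // t tS st; rewrite ltnNge; apply/negP=> tp.
by have := smax t; rewrite inE tS ltnS tp => /(_ isT); rewrite /= leqNgt st.
Qed.

Lemma split_mem u S b x : b \in split_at u S -> x \in b ->
  (x = zero_letter n /\ b = split_zero u S) \/
  exists p : 'I_n, [/\ x.1 = lift ord0 (u.1 p) &
     if cuts S p.+1 == 0%N then x.2 = false /\ b = split_zero u S
     else exists s, [/\ s \in S, (s <= p)%N, cuts S p.+1 = cuts S s.+1,
       b = normalize (split_block u S s) &
       x.2 = u.2 p (+) ~~ min_unbarred (split_block u S s)]].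
Proof.
rewrite in_setU1 => /orP[/eqP->|/imsetP[s sS ->]].
  rewrite in_split_zero => /orP[/eqP->|/existsP[p /andP[/eqP-> c0]]]; first by left.
  by right; exists p; rewrite c0.
rewrite mem_normalize in_split_block // => /existsP[p /and3P[/eqP E sp /eqP c]].
right; exists p; case: x E => a e [/= -> <-]; split=> //; rewrite c.
have -> : (cuts S s.+1 == 0)%N = false.
  by apply/negbTE/cuts0 => /(_ s sS); rewrite ltnn.
by exists s; split=> //=; rewrite -addbA addbb addbF.
Qed.

Lemma split_block_cuts u S s s' : s \in S -> s' \in S -> cuts S s.+1 = cuts S s'.+1 -> s = s'.
Proof.
wlog ss' : s s' / (s <= s')%N.
  by move=> W; case/orP: (leq_total s s') => h sS s'S E; [|symmetry]; apply: W.
move=> sS s'S /eqP /cuts_eqP H; apply/val_inj/eqP; rewrite eqn_leq ss' leqNgt /=.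
apply/negP=> lt; have := H _ s' s'S lt; rewrite ltnn ltnS ss' => /(_ isT).
by [].
Qed.

Lemma zero_normalize u S s : s \in S -> zero_letter n \notin normalize (split_block u S s).
Proof.
move=> sS; rewrite mem_normalize in_split_block //; apply/existsP => -[p /and3P[/eqP E _ _]].
by have := congr1 (fun x : sletter n => val x.1) E.
Qed.

Lemma split_PiB u S : split_at u S \in PiB n.
Proof.
(* The absolute value of a letter determines its block and its sign; disjointness, uniqueness of
   signs and the shape of the zero block all follow. *)
have U b b' x x' : b \in split_at u S -> b' \in split_at u S ->
    x \in b -> x' \in b' -> x.1 = x'.1 -> b = b' /\ x = x'.
  move=> bS b'S xb xb' E.
  case: (split_mem bS xb) => [[Ex ->]|[p [x1]]].
    case: (split_mem b'S xb') => [[-> ->]|[p' [x1']]] //.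
    by move: E; rewrite x1' Ex.
  case: (split_mem b'S xb') => [[E' _]|[p' [x1']]]; first by move: E; rewrite x1 E'.
  have -> : p' = p by apply/(@perm_inj _ u.1)/(@lift_inj _ ord0); rewrite -x1 -x1'.
  case: ifP => c; first by case=> e' -> [e ->]; split=> //; apply: injective_projections; rewrite ?E ?e ?e'.
  case=> s' [s'S _ c' -> e'] [s [sS _ cc -> e]].
  have ss : s = s' by apply: (@split_block_cuts u S) => //; rewrite -c' -cc.
  by rewrite -ss in e' *; split=> //; apply: injective_projections; rewrite ?E ?e ?e'.
have Z : split_zero u S \in split_at u S by rewrite in_setU1 eqxx.
have zZ : zero_letter n \in split_zero u S by rewrite in_split_zero eqxx.
rewrite inE; apply/and4P; split.
- apply/and3P; split=> //.
    apply/trivIsetP=> b b' bS b'S; apply: contraR => /pred0Pn[x /andP[/= xb xb']].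
    by apply/eqP; have [] := U _ _ _ _ bS b'S xb xb'.
  rewrite in_setU1; apply/norP; split.
    by apply/eqP=> E; move: zZ; rewrite -E inE.
  apply/imsetP=> -[s sS E].
  have : letter (u.1 s) (u.2 s (+) ~~ min_unbarred (split_block u S s)) \in normalize (split_block u S s).
    rewrite mem_normalize /= -addbA addbb addbF in_split_block //.
    by apply/existsP; exists s; rewrite !eqxx leqnn.
  by rewrite -E inE.
- apply/forallP=> a.
  have H1 : ~~ (((a, false) \in cover (split_at u S)) && ((a, true) \in cover (split_at u S))).
    apply/negP=> /andP[/bigcupP[b bS xb] /bigcupP[b' bS' xb']].
    by have [] := U _ _ _ _ bS bS' xb xb' erefl.
  suff : ((a, false) \in cover (split_at u S)) || ((a, true) \in cover (split_at u S)).
    by move: H1; do 2!case: (_ \in _).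
  have [->|[a' ->]] : a = ord0 \/ exists a', a = lift ord0 a'.
      by case: (unliftP ord0 a) => [a' ->|->]; [right; exists a'|left].
    by apply/orP; left; apply/bigcupP; exists (split_zero u S).
  have [p ->] : exists p, a' = u.1 p by exists ((u.1)^-1%g a'); rewrite permKV.
  have [c0|c0] := boolP (cuts S p.+1 == 0)%N.
    apply/orP; left; apply/bigcupP; exists (split_zero u S) => //.
    by rewrite in_split_zero; apply/orP; right; apply/existsP; exists p; rewrite eqxx.
  have [s [sS sp cp]] := last_cut c0.
  have : letter (u.1 p) (u.2 p (+) ~~ min_unbarred (split_block u S s)) \in normalize (split_block u S s).
    rewrite mem_normalize /= -addbA addbb addbF in_split_block //.
    by apply/existsP; exists p; rewrite eqxx sp cp eqxx.
  have bS : normalize (split_block u S s) \in split_at u S.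
    by rewrite in_setU1; apply/orP; right; apply/imsetP; exists s.
  case: (_ (+) _) => H; apply/orP; [right|left]; apply/bigcupP;
    by exists (normalize (split_block u S s)).
- apply/forall_inP=> b; rewrite in_setU1 => /orP[/eqP->|/imsetP[s sS ->]].
    apply/forall_inP=> x xZ; apply/implyP=> _.
    by case: (split_mem Z xZ) => [[-> _]|[p [_]]] //; case: ifP => [_ [-> _]|_ [s [sS _ _ Eb _]]] //;
       by have := zero_normalize u sS; rewrite -Eb zZ.
  apply: min_unbarred_normalize => x y; rewrite !in_split_block //.
  case/existsP=> p /and3P[/eqP-> _ _] /existsP[p' /and3P[/eqP-> _ _]] /= E.
  by congr letter; [|congr (u.2 _)]; first congr (u.1 _); apply/(@perm_inj _ u.1)/(@lift_inj _ ord0).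
- apply/forall_inP=> b bS; apply/implyP=> zb; apply/forall_inP=> x xb.
  have [Eb _] := U _ _ _ _ bS Z zb zZ erefl; rewrite Eb in xb.
  case: (split_mem Z xb) => [[-> _]|[p [_]]] //; case: ifP => [_ [-> _]|_ [s [sS _ _ Eb' _]]] //.
  by have := zero_normalize u sS; rewrite -Eb' zZ.
Qed.

(* The word of u with the letter 0 in front: position p of u has index p.+1. *)
Definition wd u (k : nat) : sletter n :=
  if k is k'.+1 then oapp (fun i : 'I_n => letter (u.1 i) (u.2 i)) (zero_letter n) (insub k')
  else zero_letter n.

Arguments wd : simpl never.

Lemma wdS u (p : 'I_n) : wd u p.+1 = letter (u.1 p) (u.2 p).
Proof. by rewrite /wd valK. Qed.

(** Reduces statements about [srel] on arbitrary letters to pairs of indices in the word and four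
    choices of bars. *)
Lemma wd_cases u (x : sletter n) :
  exists2 i, (i <= n)%N & x = wd u i \/ x = sbar (wd u i).
Proof.
case: x => a s; case: (unliftP ord0 a) => [a' ->|->]; last first.
  by exists 0%N => //; case: s; [right|left].
have [p ->] : exists p, a' = u.1 p by exists ((u.1)^-1%g a'); rewrite permKV.
exists p.+1 => //; rewrite wdS /sbar /letter /=.
by case: s; case: (u.2 p); by [left|right].
Qed.

Lemma split_zeroP u S i : (i <= n)%N -> cuts S i = 0%N ->
  lblock (split_at u S) (wd u i).1 = split_zero u S.
Proof.
move=> le_in c0; pose x : sletter n := ((wd u i).1, false).
have xz : x \in split_zero u S.
  rewrite /x in_split_zero; case: i le_in c0 {x} => [|i] lt_in c0; first by rewrite eqxx.
  rewrite -[i.+1]/(val (Ordinal lt_in)).+1 wdS; apply/orP; right; apply/existsP.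
  by exists (Ordinal lt_in); rewrite eqxx c0.
have Z : split_zero u S \in split_at u S by rewrite in_setU1 eqxx.
by have [] := lblock_eq (split_PiB u S) Z xz.
Qed.

Lemma split_nzeroP u S i : (i <= n)%N -> cuts S i != 0%N ->
  exists s, [/\ s \in S, cuts S i = cuts S s.+1,
    lblock (split_at u S) (wd u i).1 = normalize (split_block u S s) &
    (wd u i).2 (+) lsign (split_at u S) (wd u i).1 = ~~ min_unbarred (split_block u S s)].
Proof.
case: i => [|i] lt_in; first by case/negP; apply/cuts0.
rewrite -[i.+1]/(val (Ordinal lt_in)).+1 wdS => c0.
have [s [sS sp cp]] := last_cut c0; exists s; split=> //.
all: have bS : normalize (split_block u S s) \in split_at u S
  by rewrite in_setU1; apply/orP; right; apply/imsetP; exists s.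
all: have : letter (u.1 (Ordinal lt_in)) (u.2 (Ordinal lt_in) (+) ~~ min_unbarred (split_block u S s))
   \in normalize (split_block u S s)
  by rewrite mem_normalize /= -addbA addbb addbF in_split_block //;
     apply/existsP; exists (Ordinal lt_in); rewrite eqxx sp cp eqxx.
all: move=> xb; have [E1 E2] := lblock_eq (split_PiB u S) bS xb => //.
by rewrite -[lsign _ _]E2 /= addbA addbb.
Qed.

Lemma zero_split u S : zero_letter n \in split_zero u S.
Proof. by rewrite in_split_zero eqxx. Qed.

Lemma split_block_inj u S s s' : s \in S -> s' \in S ->
  normalize (split_block u S s) = normalize (split_block u S s') -> s = s'.
Proof.
move=> sS s'S E; apply: (@split_block_cuts u S) => //.
have : letter (u.1 s) (u.2 s (+) ~~ min_unbarred (split_block u S s)) \in normalize (split_block u S s).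
  rewrite mem_normalize /= -addbA addbb addbF in_split_block //.
  by apply/existsP; exists s; rewrite !eqxx leqnn.
rewrite E mem_normalize in_split_block // => /existsP[p /and3P[/eqP E' _ /eqP]].
by have [/perm_inj-> _] := letter_inj E'.
Qed.

Lemma split_lblock_eq u S i j : (i <= n)%N -> (j <= n)%N ->
  (lblock (split_at u S) (wd u i).1 == lblock (split_at u S) (wd u j).1) =
  (cuts S i == cuts S j).
Proof.
move=> le_in le_jn.
have [ci|ci] := eqVneq (cuts S i) 0%N; have [cj|cj] := eqVneq (cuts S j) 0%N.
- by rewrite !split_zeroP // ci cj !eqxx.
- have [s [sS _ Ej _]] := split_nzeroP u le_jn cj.
  rewrite split_zeroP // Ej ci [RHS]eq_sym (negbTE cj).
  apply/eqP=> E; have := zero_split u S; rewrite E => h.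
  by have := zero_normalize u sS; rewrite h.
- have [s [sS _ Ei _]] := split_nzeroP u le_in ci.
  rewrite [X in _ == X]split_zeroP // Ei cj (negbTE ci).
  apply/eqP=> E; have := zero_split u S; rewrite -E => h.
  by have := zero_normalize u sS; rewrite h.
have [s [sS Ci -> _]] := split_nzeroP u le_in ci.
have [s' [s'S Cj -> _]] := split_nzeroP u le_jn cj.
rewrite Ci Cj; apply/eqP/eqP => [/(split_block_inj sS s'S) -> //|].
by move/(split_block_cuts u sS s'S)->.
Qed.

Lemma split_srel u S i j : (i <= n)%N -> (j <= n)%N ->
  srel (split_at u S) (wd u i) (wd u j) = (cuts S i == cuts S j).
Proof.
move=> le_in le_jn; rewrite /srel split_lblock_eq //; case: eqP => //= E.
have [ci|ci] := eqVneq (cuts S i) 0%N; first by rewrite split_zeroP // zero_split.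
have [s [sS Ci _ ->]] := split_nzeroP u le_in ci.
have [|s' [s'S Cj _ ->]] := @split_nzeroP u S j le_jn; first by rewrite -E.
by rewrite (split_block_cuts u sS s'S) ?eqxx ?orbT // -Ci -Cj.
Qed.

Lemma split_srel_bar u S i j : (i <= n)%N -> (j <= n)%N ->
  srel (split_at u S) (sbar (wd u i)) (wd u j) = (cuts S i == 0%N) && (cuts S j == 0%N).
Proof.
move=> le_in le_jn.
have z0 k : (k <= n)%N -> srel (split_at u S) (wd u k) (zero_letter n) = (cuts S k == 0%N).
  move=> kn; rewrite (split_srel u S kn (leq0n n)).
  by rewrite (_ : cuts S 0 = 0%N) //; apply/eqP/cuts0.
apply/idP/andP => [H|[ci cj]].
  suff ij : srel (split_at u S) (wd u j) (zero_letter n).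
    split; rewrite -z0 // -srel_zero_bar ?split_PiB //.
    exact: srel_trans H ij.
  apply: srel_bar_zero; first exact: split_PiB.
  have E : cuts S i == cuts S j.
    by move: H; rewrite /srel /= split_lblock_eq // => /andP[].
  apply: srel_trans (_ : srel _ (wd u j) (wd u i)) _.
    by rewrite split_srel // eq_sym.
  by rewrite -srel_barC.
apply: srel_trans (_ : srel _ _ (zero_letter n)) _.
  by rewrite srel_zero_bar ?split_PiB // z0.
by rewrite srel_sym z0.
Qed.

Lemma split_srel0 u S i : (i <= n)%N ->
  srel (split_at u S) (wd u i) (zero_letter n) = (cuts S i == 0%N).
Proof.
move=> kn; rewrite (split_srel u S kn (leq0n n)).
by rewrite (_ : cuts S 0 = 0%N) //; apply/eqP/cuts0.
Qed.

(** The index shift matters: p = 0 relates the letter 0 to the first letter of the word, and a cut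
    at p is what breaks this relation. *)
Definition link t u (p : nat) := srel t (wd u p) (wd u p.+1).

Lemma link_split u S (p : 'I_n) : link (split_at u S) u p = (p \notin S).
Proof.
rewrite /link split_srel //; last exact: ltnW.
apply/cuts_eqP/idP => // [H|pS s sS].
  by apply/negP=> /H /(_ (leqnn _)); rewrite ltnn.
rewrite leq_eqVlt => /orP[/eqP/val_inj E|//]; by rewrite E sS in pS.
Qed.

(** Blocks of a splitting are intervals of the word, so its relation is generated by the uncut
    adjacencies, and each can be tested separately. *)
Lemma split_leP u S t : t \in PiB n ->
  reflect (forall p : 'I_n, p \notin S -> link t u p) (sple (split_at u S) t).
Proof.
move=> tP; apply: (iffP (spleP (split_PiB u S) tP)) => [H p pS|H].
  by apply: H; rewrite -(link_split u) in pS.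
have R i j : (i <= n)%N -> (j <= n)%N -> cuts S i = cuts S j -> srel t (wd u i) (wd u j).
  wlog ij : i j / (i <= j)%N.
    by move=> W; case/orP: (leq_total i j) => h *; [|rewrite srel_sym]; apply: W.
  move=> _; elim: j ij => [|j IH]; first by rewrite leqn0 => /eqP-> *; exact: srel_refl.
  rewrite leq_eqVlt => /orP[/eqP-> *|ij jn]; first exact: srel_refl.
  have cj : (cuts S i <= cuts S j <= cuts S j.+1)%N by rewrite !cuts_mono.
  move=> E; have Ej : cuts S i = cuts S j by apply/eqP; rewrite eqn_leq; case/andP: cj => -> /=; rewrite E.
  apply: srel_trans (IH _ (ltnW jn) Ej) _ => //.
  rewrite -[j]/(val (Ordinal jn)); apply: H; rewrite -(link_split u) /link split_srel //; last exact: ltnW.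
  by rewrite -Ej E.
have R0 i : (i <= n)%N -> cuts S i = 0%N -> srel t (wd u i) (zero_letter n).
  move=> h c; apply: (R i 0%N) => //; rewrite c; apply/esym/eqP; exact/cuts0.
have Rz i j : (i <= n)%N -> (j <= n)%N -> srel (split_at u S) (sbar (wd u i)) (wd u j) ->
    srel t (sbar (wd u i)) (wd u j).
  move=> h1 h2; rewrite split_srel_bar // => /andP[/eqP c1 /eqP c2].
  apply: srel_trans (_ : srel t _ (zero_letter n)) _; first by rewrite srel_zero_bar // R0.
  by rewrite srel_sym R0.
move=> x y; have [i hi [->|->]] := wd_cases u x; have [j hj [->|->]] := wd_cases u y.
- by rewrite split_srel // => /eqP; exact: R.
- by rewrite -srel_barC => /(Rz _ _ hi hj); rewrite srel_barC.
- exact: Rz.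
- by rewrite !srel_bar split_srel // => /eqP; exact: R.
Qed.

Lemma split_le u S S' : sple (split_at u S) (split_at u S') = (S' \subset S).
Proof.
apply/split_leP/subsetP => [|H p pS|H p pS]; first exact: split_PiB.
  by apply: contraTT pS => /H; rewrite link_split.
by rewrite link_split; apply: contra pS; exact: H.
Qed.

Lemma split_inj u : injective (split_at u).
Proof.
by move=> S S' E; apply/eqP; rewrite eqEsubset -!(split_le u) E split_le subxx.
Qed.

End Split.

(** * Rank and the greatest nonzero letter *)

Section Tops.
Variable n : nat.
Implicit Types (p q t : blocks n) (x y z : sletter n) (a b c : 'I_n.+1).

Definition same p a b := lblock p a == lblock p b.

Lemma same_sym p a b : same p a b = same p b a.
Proof. exact: eq_sym. Qed.

Lemma same_trans p b a c : same p a b -> same p b c -> same p a c.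
Proof. by rewrite /same => /eqP->. Qed.

Lemma srel_same p x y : srel p x y -> same p x.1 y.1.
Proof. by case/andP. Qed.

Lemma same_srel p x y : same p x.1 y.1 -> srel p x y \/ srel p (sbar x) y.
Proof.
rewrite /srel /same /= => ->; case: (_ \in _) => /=; first by left.
by case: (x.2); case: (y.2); do 2!case: lsign; by [left|right].
Qed.

Lemma srel0 p x : p \in PiB n -> srel p x (zero_letter n) = same p x.1 ord0.
Proof. exact: srel0_sign. Qed.

Lemma srel_zero2 p x y : p \in PiB n -> same p x.1 ord0 -> same p y.1 ord0 -> srel p x y.
Proof.
move=> pP; rewrite -!srel0 // => hx hy; apply: srel_trans hx _; by rewrite srel_sym.
Qed.

Lemma sple_srel p t x y : p \in PiB n -> t \in PiB n -> sple p t -> srel p x y -> srel t x y.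
Proof. by move=> pP tP /(spleP pP tP); apply. Qed.

Lemma sple_same p t a b : p \in PiB n -> t \in PiB n -> sple p t -> same p a b -> same t a b.
Proof.
move=> pP tP pt /(@same_srel p (a, false) (b, false))[] /(sple_srel pP tP pt) /srel_same //.
Qed.

Lemma srel_bar_same0 p x y : p \in PiB n -> srel p x y -> srel p (sbar x) y -> same p x.1 ord0.
Proof.
move=> pP h1 h2; rewrite -srel0 //; apply: srel_bar_zero => //.
by apply: srel_trans h1 _; rewrite srel_sym.
Qed.

(* One letter per nonzero block, so #|tops p| is the corank of p; unlike a count
   of blocks, the set itself is monotone (tops_anti). *)
Definition tops p := [set a : 'I_n.+1 | ~~ same p a ord0 & [forall b : 'I_n.+1, (a < b)%N ==> ~~ same p a b]].

Lemma topsP p a : reflect (~~ same p a ord0 /\ forall b, same p a b -> (b <= a)%N) (a \in tops p).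
Proof.
rewrite inE; apply: (iffP andP) => -[h H]; split=> //.
  move=> b; apply: contraTT; rewrite -ltnNge => ab.
  by have /implyP/(_ ab) := forallP H b.
apply/forallP=> b; apply/implyP=> ab; apply: contraL ab => /H.
by rewrite -leqNgt.
Qed.

Lemma tops_nz p a : a \in tops p -> ~~ same p a ord0.
Proof. by case/topsP. Qed.

Lemma tops_uniq p a b : a \in tops p -> b \in tops p -> same p a b -> a = b.
Proof.
move=> /topsP[_ Ha] /topsP[_ Hb] ab; apply/val_inj/eqP; rewrite eqn_leq Ha // Hb //.
by rewrite same_sym.
Qed.

Lemma top_exists p a : ~~ same p a ord0 -> exists2 c, c \in tops p & same p c a && (a <= c)%N.
Proof.
move=> nza; have := @arg_maxnP _ a (fun c => same p c a) (fun c => val c) (eqxx _).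
case=> c ca cmax; exists c; last by rewrite ca; apply: cmax; rewrite /same.
apply/topsP; split; first by apply: contra nza; apply: same_trans; rewrite same_sym.
by move=> b cb; apply: cmax; apply: same_trans ca; rewrite same_sym.
Qed.

Lemma tops_anti p t : p \in PiB n -> t \in PiB n -> sple p t -> tops t \subset tops p.
Proof.
move=> pP tP pt; apply/subsetP=> a /topsP[nz H]; apply/topsP; split.
  by apply: contra nz; exact: sple_same.
by move=> b /(sple_same pP tP pt); exact: H.
Qed.

(** A nonzero block of [t] has only one top, so distinct blocks of [p] through tops of [t] are not
    merged in [t], nor sent to zero; and relating both signs of a letter would send it to zero. *)
Lemma srel_local p t x y : p \in PiB n -> t \in PiB n -> sple p t ->
  same p x.1 ord0 \/ (exists2 c, c \in tops t & same p c x.1) ->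
  same p y.1 ord0 \/ (exists2 c, c \in tops t & same p c y.1) ->
  srel t x y -> srel p x y.
Proof.
move=> pP tP pt.
have W x' y' : same p x'.1 ord0 -> (exists2 c, c \in tops t & same p c y'.1) -> srel t x' y' -> False.
  move=> hx [c ct cy] /srel_same xy; have /negP := tops_nz ct; apply.
  apply: same_trans (sple_same pP tP pt cy) _; rewrite same_sym in xy.
  by apply: same_trans xy _; exact: sple_same hx.
case=> hx [] hy xy; first exact: srel_zero2.
- by case: (W _ _ hx hy xy).
- by rewrite srel_sym in xy; case: (W _ _ hy hx xy).
case: hx hy => c ct cx [c' c't cy].
have cc' : c = c'.
  apply: (tops_uniq ct c't); apply: same_trans (sple_same pP tP pt cx) _.
  apply: same_trans (srel_same xy) _; rewrite same_sym; exact: sple_same cy.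
have pxy : same p x.1 y.1 by apply: same_trans cy; rewrite -cc' same_sym.
case: (same_srel pxy) => // /(sple_srel pP tP pt) xy'.
have /negP := tops_nz ct; case; apply: same_trans (sple_same pP tP pt cx) _.
exact: srel_bar_same0 xy xy'.
Qed.

(** With equal coranks the tops coincide, so every letter falls under [srel_local]. *)
Lemma sple_tops_eq p t : p \in PiB n -> t \in PiB n -> sple p t ->
  (#|tops p| <= #|tops t|)%N -> p = t.
Proof.
move=> pP tP pt le; have E : tops t = tops p by apply/eqP; rewrite eqEcard tops_anti.
apply: sple_anti => //; apply/spleP => // x y.
have R z : same p z.1 ord0 \/ (exists2 c, c \in tops t & same p c z.1).
  have [|nz] := boolP (same p z.1 ord0); first by left.
  by right; have [c cp /andP[cz _]] := top_exists nz; exists c; rewrite ?E.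
exact: srel_local.
Qed.

Lemma sple_tops_lt p t : p \in PiB n -> t \in PiB n -> sple p t -> p != t ->
  (#|tops t| < #|tops p|)%N.
Proof.
move=> pP tP pt; apply: contraR; rewrite -leqNgt => h; apply/eqP; exact: sple_tops_eq.
Qed.

Lemma card_tops_le p : (#|tops p| <= n)%N.
Proof.
have : tops p \subset [set~ ord0].
  by apply/subsetP=> a /topsP[h _]; rewrite !inE; apply: contraNneq h => ->; rewrite /same.
by move/subset_leq_card; rewrite cardsC1 card_ord.
Qed.

(** No blocks are counted: adding cuts one at a time raises the corank strictly, and it stays
    between 0 and n, which forces equality along a full chain of cut sets. *)
Lemma card_tops_split u S : #|tops (split_at u S)| = #|S|.
Proof.
apply/eqP; rewrite eqn_leq; apply/andP; split.
  suff : (#|tops (split_at u S)| + #|~: S| <= n)%N.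
    have := cardsC S; rewrite card_ord => E H.
    by rewrite -(leq_add2r #|~: S|) E.
  elim: {S}_.+1 {-2}S (ltnSn #|~: S|) => // k IH S; rewrite ltnS => le.
  have [E|[s]] := set_0Vmem (~: S); first by rewrite E cards0 addn0 card_tops_le.
  rewrite inE => sS.
  have E : ~: S = s |: ~: (s |: S).
    by apply/setP=> x; rewrite !inE; case: eqP => // ->.
  have cE : #|~: S| = #|~: (s |: S)|.+1 by rewrite {1}E cardsU1 !inE eqxx.
  rewrite cE addnS -addSn.
  have lt : (#|tops (split_at u S)| < #|tops (split_at u (s |: S))|)%N.
    apply: sple_tops_lt; rewrite ?split_PiB ?split_le ?subsetU1 //.
    by apply/eqP=> /split_inj E'; move: sS; rewrite -E' setU11.
  have IH' : (#|tops (split_at u (s |: S))| + #|~: (s |: S)| <= n)%N.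
    by apply: IH; rewrite -ltnS -cE.
  by apply: leq_trans IH'; rewrite leq_add2r.
elim: {S}_.+1 {-2}S (ltnSn #|S|) => // k IH S; rewrite ltnS => le.
have [->|[s sS]] := set_0Vmem S; first by rewrite cards0.
have cE := cardsD1 s S; rewrite sS /= add1n in cE; rewrite cE.
have lt : (#|tops (split_at u (S :\ s))| < #|tops (split_at u S)|)%N.
  apply: sple_tops_lt; rewrite ?split_PiB ?split_le ?subsetDl //.
  by apply/eqP=> /split_inj E'; move: sS; rewrite E' setD11.
by apply: leq_ltn_trans lt; apply: IH; rewrite -ltnS -cE.
Qed.

(* ord0 is a junk value, taken only when every letter is in the zero block. *)
Definition Mx p := odflt ord0 [pick a : 'I_n.+1 | ~~ same p a ord0 &
  [forall b : 'I_n.+1, ~~ same p b ord0 ==> (b <= a)%N]].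

Lemma MxP p : tops p != set0 ->
  ~~ same p (Mx p) ord0 /\ forall b, ~~ same p b ord0 -> (b <= Mx p)%N.
Proof.
case/set0Pn=> a0 /tops_nz nz; rewrite /Mx; case: pickP => [a /andP[h /forallP H]|no] /=.
  by split=> // b; move: (H b) => /implyP.
have [a ha amax] := @arg_maxnP _ a0 (fun c => ~~ same p c ord0) (fun c => val c) nz.
have := no a; rewrite ha /= => /forallP[] b; apply/implyP; exact: amax.
Qed.

Lemma Mx_tops p : tops p != set0 -> Mx p \in tops p.
Proof.
move=> h; have [nz H] := MxP h; apply/topsP; split=> // b Mb; apply: H.
by apply: contra nz; exact: same_trans.
Qed.

Lemma Mx_eq p t : p \in PiB n -> t \in PiB n -> sple p t -> tops p != set0 ->
  ~~ same t (Mx p) ord0 -> Mx t = Mx p /\ tops t != set0.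
Proof.
move=> pP tP pt h nz; have [nzp Hp] := MxP h.
have tn : tops t != set0.
  by have [c ct _] := top_exists nz; apply/set0Pn; exists c.
have [nzt Ht] := MxP tn; split=> //; apply/val_inj/eqP; rewrite eqn_leq Ht // Hp //.
by apply: contra nzt; exact: sple_same.
Qed.

Definition changed p t := [exists x : sletter n, srel t x (Mx p, false) && ~~ srel p x (Mx p, false)].

Lemma unchangedP p t x : ~~ changed p t -> srel t x (Mx p, false) -> srel p x (Mx p, false).
Proof. by move/existsPn/(_ x); case: (srel t _ _) => //=; rewrite negbK. Qed.

Lemma changed_zero p t : p \in PiB n -> t \in PiB n -> tops p != set0 -> same t (Mx p) ord0 -> changed p t.
Proof.
move=> pP tP h z; apply/existsP; exists (zero_letter n).
rewrite srel_sym srel0 // z /= srel_sym srel0 //.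
by have [] := MxP h.
Qed.

(* In a covering step that changes the block of the greatest nonzero letter,
   only that block is merged with something. *)
Lemma srel_outside p t x y : p \in PiB n -> t \in PiB n -> sple p t ->
  #|tops p| = #|tops t|.+1 -> changed p t ->
  ~~ same p x.1 (Mx p) -> ~~ same p y.1 (Mx p) -> srel t x y -> srel p x y.
Proof.
move=> pP tP pt card /existsP[v /andP[tv pv]].
have sub := tops_anti pP tP pt.
have [a /setDP[ap chain_at]] : exists a, a \in tops p :\: tops t.
  by apply/set0Pn; rewrite -cards_eq0 cardsDS // card subSnn.
have Ep : tops p = a |: tops t.
  by apply/esym/eqP; rewrite eqEcard subUset sub1set ap sub /= cardsU1 chain_at card.
have pn : tops p != set0 by apply/set0Pn; exists a.
pose good b := same p b ord0 \/ exists2 c, c \in tops t & same p c b.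
have gd b : good b \/ same p a b.
  have [|nz] := boolP (same p b ord0); first by left; left.
  have [c cp /andP[cb _]] := top_exists nz.
  by move: cp; rewrite Ep in_setU1 => /orP[/eqP <-|ct]; [right|left; right; exists c].
have Mp := Mx_tops pn.
(* If the lost top [a] is [Mx p], every letter outside its block is good. Otherwise the change at
   [Mx p] can only come from absorbing the block of [a], whose letters are then treated apart. *)
have [Mt|Mt] := boolP (Mx p \in tops t); last first.
  have -> : Mx p = a by move: Mp; rewrite Ep in_setU1 (negbTE Mt) orbF => /eqP.
  move=> nx ny xy; apply: srel_local xy => //.
    by case: (gd x.1) => // h; rewrite same_sym h in nx.
  by case: (gd y.1) => // h; rewrite same_sym h in ny.
have gM : good (Mx p) by right; exists (Mx p) => //; rewrite /same.
have av : same p a v.1.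
  by case: (gd v.1) => // gv; have := @srel_local p t v (Mx p, false) pP tP pt gv gM tv; rewrite (negbTE pv).
have aM : same t a (Mx p) by apply: same_trans (sple_same pP tP pt av) (srel_same tv).
have gn z : good z.1 -> ~~ same p z.1 (Mx p) -> ~~ same t z.1 (Mx p).
  move=> gz; apply: contra => /(@same_srel _ z (Mx p, false))[].
    by move/(@srel_local p t z (Mx p, false) pP tP pt gz gM)/srel_same.
  by move/(@srel_local p t (sbar z) (Mx p, false) pP tP pt gz gM)/srel_same.
move=> nx ny xy; case: (gd x.1) => gx; case: (gd y.1) => gy.
- exact: (@srel_local p t x y).
- have /negP[] := gn _ gx nx; apply: same_trans (srel_same xy) _.
  by apply: same_trans aM; rewrite same_sym; exact: sple_same gy.
- have /negP[] := gn _ gy ny; apply: same_trans (_ : same t _ x.1) _.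
    by rewrite same_sym; exact: srel_same.
  by apply: same_trans aM; rewrite same_sym; exact: sple_same gx.
have pxy : same p x.1 y.1 by apply: same_trans gy; rewrite same_sym.
case: (same_srel pxy) => // /(sple_srel pP tP pt) xy'.
have /negP[] := tops_nz Mt; rewrite same_sym in aM; apply: same_trans aM _.
by apply: same_trans (sple_same pP tP pt gx) _; exact: srel_bar_same0 xy xy'.
Qed.

(** Near the greatest letter [p'] relates no more than [q]; away from it, [srel_outside] brings the
    relations of [t] back to [p]. So [p'] lies below [p], and the coranks agree. *)
Lemma unchanged_eq q p p' t : q \in PiB n -> p \in PiB n -> p' \in PiB n -> t \in PiB n ->
  tops q != set0 ->
  sple q p -> sple q p' -> sple p t -> sple p' t ->
  #|tops p| = #|tops t|.+1 -> #|tops p'| = #|tops p| ->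
  ~~ changed q p -> ~~ changed q p' -> changed p t -> p' = p.
Proof.
move=> qP pP p'P tP qn qp qp' pt p't cpt cpp nqp nqp' cht.
have [Mpq pn] : Mx p = Mx q /\ tops p != set0.
  by apply: Mx_eq => //; apply: contra nqp; exact: changed_zero.
apply: sple_tops_eq; rewrite ?cpp //; apply/spleP=> // x y xy.
have nc (r : blocks n) z : r \in PiB n -> sple q r -> ~~ changed q r -> same r z.1 (Mx q) -> same q z.1 (Mx q).
  move=> rP qr cr /(@same_srel _ z (Mx q, false))[] /(unchangedP cr)/srel_same //.
have [sx|sx] := boolP (same q x.1 (Mx q)).
  suff : srel q x y by exact: sple_srel.
  case: (@same_srel q x (Mx q, false) sx) => h.
    apply: (srel_trans h); rewrite srel_sym; apply: (unchangedP nqp').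
    by apply: srel_trans (sple_srel qP p'P qp' h); rewrite srel_sym.
  rewrite -srel_bar; apply: (srel_trans h); rewrite srel_sym; apply: (unchangedP nqp').
  by apply: srel_trans (sple_srel qP p'P qp' h); rewrite srel_bar srel_sym.
have sy : ~~ same q y.1 (Mx q).
  apply: contra sx => h; apply: (nc p') => //; apply: same_trans (srel_same xy) _.
  exact: sple_same h.
apply: srel_outside pt cpt cht _ _ _ => //.
- by rewrite Mpq; apply: contra sx; exact: nc.
- by rewrite Mpq; apply: contra sy; exact: nc.
- exact: sple_srel xy.
Qed.

End Tops.

(** * Cycles in top degree *)

Section Homology.
Local Open Scope ring_scope.
Variables (V : finType) (le : rel V).
Implicit Types (P C D : {set V}) (c z : ochain V) (d : int).

Lemma boundaryB : {morph boundary le : c c' / c - c'}.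
Proof.
move=> c c'; apply/ffunP=> D; rewrite !ffunE -sumrB; apply: eq_bigr => C _.
by rewrite -sumrB; apply: eq_bigr => x _; rewrite !ffunE mulrBr.
Qed.

HB.instance Definition _ := GRing.isZmodMorphism.Build _ _ (boundary le) boundaryB.

Lemma ochainMz c (a : int) C : (c *~ a) C = c C * a.
Proof.
case: a => k; first by rewrite -pmulrn ffunMnE -mulr_natr natz.
by rewrite NegzE mulrNz -pmulrn !ffunE ffunMnE -mulr_natr natz mulrN.
Qed.

Lemma ochainB c c' C : (c - c') C = c C - c' C.
Proof. by rewrite !ffunE. Qed.

Lemma is_boundary_top P d c : (forall C, ~~ simplex le P (d + 1) C) ->
  is_boundary le P d c -> c = 0.
Proof.
move=> no [b bP ->]; rewrite (_ : b = 0) ?raddf0 //.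
by apply/ffunP=> C; rewrite ffunE; apply/eqP; apply: contraT => /bP; rewrite (negbTE (no C)).
Qed.

Lemma is_cycleB P d (I : finType) c (z : I -> ochain V) (a : I -> int) :
  is_cycle le P d c -> (forall i, is_cycle le P d (z i)) ->
  is_cycle le P d (c - \sum_i z i *~ a i).
Proof.
move=> [cd cb] zP; split; last first.
  rewrite raddfB /= cb raddf_sum /= sub0r big1 ?oppr0 // => i _.
  by rewrite raddfMz /=; have [_ ->] := zP i; rewrite mul0rz.
move=> C; rewrite !ffunE sum_ffunE.
have [cC|] := eqVneq (c C) 0; last by move=> ? _; exact: cd.
rewrite cC sub0r oppr_eq0 => nz.
have [i] : exists i, (z i *~ a i) C != 0.
  apply/existsP; apply: contra_neqT nz; rewrite negb_exists => /forallP H.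
  by apply: big1 => i _; apply/eqP; rewrite -[_ == _]negbK.
rewrite ochainMz mulf_eq0 negb_or => /andP[h _].
by have [zd _] := zP i; exact: zd.
Qed.

(** Without simplices in degree d + 1, homology classes are cycles. The diagonal entries have square
    1, hence are invertible over the integers. *)
Lemma homology_basis_triangular P d (I : finType) (z : I -> ochain V)
    (F : I -> {set V}) (h : I -> nat) :
  (forall C, ~~ simplex le P (d + 1) C) ->
  (forall i, is_cycle le P d (z i)) ->
  (forall i, z i (F i) * z i (F i) = 1) ->
  (forall i j, z i (F j) != 0 -> i = j \/ (h i < h j)%N) ->
  (forall c, is_cycle le P d c -> (forall i, c (F i) = 0) -> c = 0) ->
  homology_basis le P d z.
Proof.
move=> no zP z1 tri van; split=> // [c cP|a /(is_boundary_top no) E].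
  suff H k : exists a : I -> int, forall i, (h i < k)%N -> (c - \sum_i z i *~ a i) (F i) = 0.
    have [a Ha] := H (\max_i h i).+1.
    exists a; exists 0; first by move=> C; rewrite ffunE eqxx.
    rewrite raddf0; apply: van; first exact: is_cycleB.
    by move=> i; apply: Ha; rewrite ltnS; apply: (leq_bigmax i).
  elim: k => [|k [a Ha]]; first by exists (fun=> 0).
  set c' := c - _ in Ha.
  (* [z i (F i)] is its own inverse, so this cancels the value at [F i]; by triangularity, a
     correction at height k affects no other facet of height at most k. *)
  pose b i := if h i == k then c' (F i) * z i (F i) else 0.
  exists (fun i => a i + b i) => j.
  have -> : c - \sum_i z i *~ (a i + b i) = c' - \sum_i z i *~ b i.
    rewrite /c' -addrA -opprD -big_split /=; congr (_ - _).
    by apply: eq_bigr => i _; rewrite mulrzDr.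
  rewrite ltnS leq_eqVlt ochainB sum_ffunE => jk.
  have E i : i != j -> (z i *~ b i) (F j) = 0.
    rewrite ochainMz /b => ij; case: eqP => [hi|_]; last by rewrite mulr0.
    have [->|nz] := eqVneq (z i (F j)) 0; first by rewrite mul0r.
    case: (tri _ _ nz) => [Eij|]; first by rewrite Eij eqxx in ij.
    by rewrite hi; case/orP: jk => [/eqP->|]; lia.
  rewrite (bigD1 j) //= big1 // addr0 ochainMz /b.
  case/orP: jk => [/eqP hj|hj].
    by rewrite hj eqxx mulrCA z1 mulr1 subrr.
  by rewrite (ltn_eqF hj) mulr0 subr0; exact: Ha.
move=> i; apply/eqP; apply: contraT => ai.
have [j aj jmin] := @arg_minnP _ i (fun j => a j != 0) h ai.
have := congr1 (fun c : ochain V => c (F j)) E; rewrite sum_ffunE ffunE.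
rewrite (bigD1 j) //= big1 ?addr0 => [|k kj].
  rewrite ochainMz => /(congr1 (fun t => z j (F j) * t)); rewrite mulrA z1 mul1r mulr0.
  by move/eqP: aj.
rewrite ochainMz; have [->|nz] := eqVneq (z k (F j)) 0; first by rewrite mul0r.
case: (tri _ _ nz) => [Ekj|hkj]; first by rewrite Ekj eqxx in kj.
have [->|ak] := eqVneq (a k) 0; first by rewrite mulr0.
by have := jmin _ ak; rewrite leqNgt hkj.
Qed.

(** At the face C minus x, the boundary of [c] has only the term of [C] left, up to sign. *)
Lemma cycle_isolated c C x : boundary le c = 0 -> x \in C ->
  (forall C' y, y \in C' -> C' :\ y = C :\ x -> C' != C -> c C' = 0) -> c C = 0.
Proof.
move=> cb xC H; have := congr1 (fun f : ochain V => f (C :\ x)) cb; rewrite !ffunE.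
rewrite (bigD1 C) //= [X in _ + X]big1 ?addr0 => [|C' C'C]; last first.
  by apply: big1 => y /andP[yC' /eqP E]; rewrite (H C' y) ?mulr0.
rewrite (bigD1 x) /= ?xC ?eqxx // [X in _ + X]big1 ?addr0 => [|y /andP[/andP[yC /eqP E] yx]]; last first.
  by have := setD11 x C; rewrite -E !inE [x == y]eq_sym yx xC.
by move/eqP; rewrite mulf_eq0 signr_eq0 => /eqP.
Qed.

(** The cycle [z] is an integer multiple of [rho], so a unit coefficient of [z] forces one of [rho].
    This lets an explicit cycle control an abstract fundamental one. *)
Lemma fundamental_coef P d rho z C : (forall C, ~~ simplex le P (d + 1) C) ->
  fundamental_cycle le P d rho -> is_cycle le P d z -> z C * z C = 1 ->
  rho C * rho C = 1.
Proof.
move=> no [_ span _] zP zC; have [a /(is_boundary_top no)] := span z zP.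
rewrite (bigD1 tt) //= big1 => [|[] //]; rewrite addr0 => /eqP; rewrite subr_eq0 => /eqP Ez.
move: zC; rewrite Ez ochainMz; move: (rho C) (a tt) => r s.
move=> rs; have /intUnitRing.unitzPl : (s * (r * s)) * r = 1 by rewrite mulrC -rs !mulrA.
by case/orP=> /eqP->.
Qed.

(** * The explicit top-dimensional cycle of a Boolean lattice *)

Section BooleanCycle.
Variables (m : nat) (g : {set 'I_m.+1} -> V) (P : {set V}) (d : int).
Hypothesis gle : forall S S', le (g S) (g S') = (S' \subset S).
Hypothesis gP : forall S, S != set0 -> S != setT -> g S \in P.
Hypothesis dm : m%:Z = d + 1.

Implicit Types (s t : 'S_m.+1).

Definition bset s (j : nat) := [set p | (j < s p)%N].
Definition bchain s : {set V} := [set g (bset s j) | j : 'I_m].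

Lemma g_inj : injective g.
Proof.
by move=> S S' E; apply/eqP; rewrite eqEsubset -!gle E gle subxx.
Qed.

Lemma bset_sub s (j k : nat) : (j < m)%N -> (k < m)%N -> (bset s k \subset bset s j) = (j <= k)%N.
Proof.
move=> jm km; apply/subsetP/idP => [|jk p]; last by rewrite !inE; exact: leq_ltn_trans.
move/(_ ((s^-1)%g (inord k.+1))); rewrite !inE permKV inordK // ltnS.
by move/(_ (leqnn _)).
Qed.

Lemma bset_proper s (j : nat) : (j < m)%N -> bset s j != set0 /\ bset s j != setT.
Proof.
move=> jm; split.
  by apply/set0Pn; exists ((s^-1)%g (inord j.+1)); rewrite !inE permKV inordK.
apply/eqP=> /setP/(_ ((s^-1)%g ord0)); rewrite !inE permKV //.
Qed.

Lemma bset_inj s (j k : 'I_m) : bset s j = bset s k -> j = k.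
Proof.
move=> E; apply/val_inj/eqP; rewrite eqn_leq.
by rewrite -(bset_sub s (ltn_ord j) (ltn_ord k)) -(bset_sub s (ltn_ord k) (ltn_ord j)) E subxx.
Qed.

Lemma gbset_inj s : injective (fun j : 'I_m => g (bset s j)).
Proof. by move=> j k /g_inj/bset_inj. Qed.

Lemma card_bset s (j : nat) : #|bset s j| = #|bset 1 j|.
Proof.
rewrite -(card_preimset (bset 1 j) (@perm_inj _ s)).
by apply: eq_card => p; rewrite !inE perm1.
Qed.

(** The cardinality of [bset s j] depends only on j, so the chain determines each of its sets
    together with its index, hence [s]. *)
Lemma bchain_inj : injective bchain.
Proof.
move=> s t E; have B (j : 'I_m) : bset s j = bset t j.
  have : g (bset s j) \in bchain t by rewrite -E; apply/imsetP; exists j.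
  case/imsetP=> k _ /g_inj Ejk; rewrite Ejk; congr (bset t _).
  have ck := card_bset s j; rewrite Ejk card_bset in ck.
  congr val; apply: (@bset_inj 1); apply/eqP.
  by have /orP[h|h] := leq_total j k; [|rewrite eq_sym]; rewrite eqEcard bset_sub // h ck leqnn.
have le1 s1 t1 p : (forall j : 'I_m, bset s1 j = bset t1 j) -> (s1 p <= t1 p)%N.
  move=> B1; case sp: (val (s1 p)) => [|k] //.
  have km : (k < m)%N by have := ltn_ord (s1 p); rewrite [nat_of_ord _]sp.
  have : p \in bset s1 (Ordinal km) by rewrite inE [nat_of_ord (s1 p)]sp ltnSn.
  by rewrite B1 inE.
by apply/permP=> p; apply/val_inj/eqP; rewrite eqn_leq !le1.
Qed.

Definition bcycle : ochain V :=
  [ffun C => \sum_s (if C == bchain s then (-1) ^+ s else 0)].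

Lemma bcycleE s : bcycle (bchain s) = (-1) ^+ s.
Proof.
rewrite ffunE (bigD1 s) //= eqxx big1 ?addr0 // => t ts.
by rewrite (inj_eq bchain_inj) eq_sym (negbTE ts).
Qed.

Lemma bset_swap s (j : 'I_m) (k : nat) : k != j ->
  bset (s * tperm (inord j) (inord j.+1)) k = bset s k.
Proof.
move=> kj; apply/setP=> p; rewrite !inE permM.
have jm := ltn_ord j.
by case: tpermP => // ->; rewrite ?inordK //; lia.
Qed.

(** Exchanging the values j and j + 1 of [s] alters only the j-th set of the chain: the face
    omitting it is kept and the sign of [s] is reversed, so contributions cancel in pairs. *)
Lemma bcycle_cycle : is_cycle le P d bcycle.
Proof.
split=> [C|].
  rewrite ffunE => nz; have [s /eqP->] : exists s, C == bchain s.
    apply/existsP; apply: contra_neqT nz; rewrite negb_exists => /forallP H.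
    by apply: big1 => s _; rewrite (negbTE (H s)).
  apply/and3P; split.
  - apply/subsetP=> _ /imsetP[j _ ->]; have [? ?] := bset_proper s (ltn_ord j).
    exact: gP.
  - apply/forall_inP=> _ /imsetP[j _ ->]; apply/forall_inP=> _ /imsetP[k _ ->].
    by rewrite !gle !bset_sub // leq_total.
  by rewrite card_imset ?card_ord ?dm //; exact: gbset_inj.
apply/ffunP=> D; rewrite ffunE [RHS]ffunE.
pose w s (j : 'I_m) : int := if [set g (bset s k) | k : 'I_m & k != j] == D
  then (-1) ^+ #|[set g (bset s k) | k : 'I_m & (k < j)%N]| else 0.
transitivity (\sum_(s : 'S_m.+1) \sum_(j : 'I_m) (-1) ^+ s * w s j).
  transitivity (\sum_C \sum_(s : 'S_m.+1) (if C == bchain s then \sum_(x in C | C :\ x == D)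
     (-1) ^+ #|[set y in C | (y != x) && le y x]| * (-1) ^+ s else 0 : int)).
    apply: eq_bigr => C _.
    transitivity (\sum_(x in C | C :\ x == D) \sum_(s : 'S_m.+1) (if C == bchain s then
       (-1) ^+ #|[set y in C | (y != x) && le y x]| * (-1) ^+ s else 0 : int)).
      apply: eq_bigr => x _; rewrite ffunE mulr_sumr; apply: eq_bigr => s _.
      by case: eqP => // _; rewrite mulr0.
    rewrite exchange_big; apply: eq_bigr => s _; case: eqP => // _.
    by apply: big1.
  rewrite exchange_big; apply: eq_bigr => s _.
  rewrite (bigD1 (bchain s)) //= eqxx [X in _ + X]big1 ?addr0 => [|C /negbTE-> //].
  rewrite big_mkcondr /= big_imset /=; last by move=> j k _ _; exact: gbset_inj.
  apply: eq_big => // j _; rewrite /w.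
  have -> : bchain s :\ g (bset s j) = [set g (bset s k) | k : 'I_m & k != j].
    apply/setP=> x; rewrite !inE; apply/andP/imsetP => [[xj /imsetP[k _ E]]|[k]].
      by exists k => //; rewrite inE; apply: contra_neq xj => <-.
    rewrite inE => kj ->; split; last by apply/imsetP; exists k.
    by rewrite (inj_eq (@gbset_inj s)).
  case: eqP => _; last by rewrite mulr0.
  rewrite mulrC; congr (_ * (-1) ^+ #|pred_of_set _|).
  apply/setP=> x; rewrite !inE; apply/andP/imsetP => [[/imsetP[k _ ->]]|[k]].
    rewrite gle bset_sub // (inj_eq (@gbset_inj s)) => /andP[kj le_kj]; exists k => //.
    by rewrite inE ltn_neqAle kj.
  rewrite inE => kj ->; split; first by apply/imsetP; exists k.
  by rewrite gle bset_sub // (inj_eq (@gbset_inj s)) -ltn_neqAle.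
rewrite exchange_big big1 // => j _.
pose t := tperm (inord j : 'I_m.+1) (inord j.+1).
have jm := ltn_ord j.
have oddt : odd_perm t = true.
  by rewrite odd_tperm; apply/eqP=> /(congr1 val); rewrite /= !inordK //; lia.
have ws s : w (s * t)%g j = w s j.
  have E (Q : pred 'I_m) : (forall k, Q k -> k != j) ->
      [set g (bset (s * t)%g k) | k : 'I_m & Q k] = [set g (bset s k) | k : 'I_m & Q k].
    by move=> H; apply: eq_in_imset => k; rewrite inE => /H kj; rewrite bset_swap.
  by rewrite /w !E // => k; apply: contraTneq => ->; rewrite ltnn.
have : \sum_(s : 'S_m.+1) (-1) ^+ s * w s j = - \sum_(s : 'S_m.+1) (-1) ^+ s * w s j.
  rewrite {1}(reindex_inj (mulIg t)) /= -sumrN; apply: eq_bigr => s _.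
  by rewrite ws odd_permM oddt addbT signrN mulNr.
by move: (\sum_(s : 'S_m.+1) _) => x; lia.
Qed.

End BooleanCycle.
End Homology.

(** The base 3 value of a record; [d 0] is the most significant digit, so numerical order is
    lexicographic order. *)
Fixpoint ternary (d : nat -> nat) k := if k is k'.+1 then 3 * ternary d k' + d k' else 0.

Lemma ternary_lt (d d' : nat -> nat) k i : (forall j, d j <= 2) ->
  (forall j, j < k -> d j = d' j) -> d k < d' k -> k < i -> ternary d i < ternary d' i.
Proof.
move=> d2 eq lt; elim: i => // i IH; rewrite ltnS leq_eqVlt => /orP[/eqP<-|/IH] /=; last first.
  by have := d2 i; lia.
suff -> : ternary d k = ternary d' k by rewrite ltn_add2l.
elim: k eq {lt IH} => //= k IH eq; rewrite IH ?eq // => j jk; exact/eq/ltnW.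
Qed.

Lemma ternary_ub (d : nat -> nat) i : (forall j, d j <= 2) -> ternary d i < 3 ^ i.
Proof.
by move=> d2; elim: i => //= i IH; rewrite expnS; have := d2 i; lia.
Qed.

(** * Maximal chains *)

Section BotTop.
Variable n : nat.
Implicit Types (x y t : blocks n) (u : sperm n).

Definition id_sperm : sperm n := (1%g, [ffun=> false]).
Definition bot := split_at id_sperm setT.
Definition top := split_at id_sperm set0.

Lemma split_setT_le u t : t \in PiB n -> sple (split_at u setT) t.
Proof. by move=> tP; apply/split_leP => // p; rewrite inE. Qed.

Lemma same_split0 u a : same (split_at u set0) a ord0.
Proof.
have [i le_in E] := wd_cases u (a, false).
have -> : a = (wd u i).1 by case: E => /(congr1 fst).
by rewrite -srel0 ?split_PiB // split_srel0 //; apply/cuts0 => s; rewrite inE.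
Qed.

Lemma split_set0_ge u t : t \in PiB n -> sple t (split_at u set0).
Proof.
move=> tP; apply/spleP=> //; first exact: split_PiB.
by move=> x y _; apply: srel_zero2; rewrite ?split_PiB ?same_split0.
Qed.

Lemma split_setT u : split_at u setT = bot.
Proof. by apply: sple_anti; rewrite ?split_PiB ?split_setT_le ?split_PiB. Qed.

Lemma split_set0 u : split_at u set0 = top.
Proof. by apply: sple_anti; rewrite ?split_PiB ?split_set0_ge ?split_PiB. Qed.

Lemma bot_PiB : bot \in PiB n. Proof. exact: split_PiB. Qed.
Lemma top_PiB : top \in PiB n. Proof. exact: split_PiB. Qed.
Lemma bot_le t : t \in PiB n -> sple bot t. Proof. exact: split_setT_le. Qed.
Lemma le_top t : t \in PiB n -> sple t top. Proof. exact: split_set0_ge. Qed.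
Lemma same_top a b : same top a b.
Proof. by apply: (same_trans (same_split0 _ a)); rewrite same_sym same_split0. Qed.
Lemma card_tops_bot : #|tops bot| = n.
Proof. by rewrite card_tops_split cardsT card_ord. Qed.
Lemma card_tops_top : #|tops top| = 0.
Proof. by rewrite card_tops_split cards0. Qed.

Lemma tops_bot x : x \in PiB n -> #|tops x| = n -> x = bot.
Proof.
by move=> xP E; apply/esym/sple_tops_eq; rewrite ?bot_PiB ?bot_le // card_tops_bot E.
Qed.

Lemma tops_top x : x \in PiB n -> #|tops x| = 0 -> x = top.
Proof.
by move=> xP E; apply/sple_tops_eq; rewrite ?top_PiB ?le_top // E.
Qed.

(** Corank n forces the bottom and corank 0 the top, so the proper part of every subposet containing
    both is cut out by the same condition. *)
Lemma proper_partE (Q : {set blocks n}) x : Q \subset PiB n -> bot \in Q -> top \in Q ->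
  (x \in proper_part (@sple n) Q) = (x \in Q) && (0 < #|tops x| < n).
Proof.
move=> /subsetP QB bQ tQ; rewrite inE; case xQ: (x \in Q) => //=.
have xP := QB _ xQ.
have -> : [forall y in Q, sple x y] = (#|tops x| == n).
  apply/forall_inP/eqP => [H|/(tops_bot xP)-> y yQ]; last exact/bot_le/QB.
  apply/eqP; rewrite eqn_leq card_tops_le -{1}card_tops_bot.
  by apply/subset_leq_card/tops_anti; rewrite ?bot_PiB ?H.
have -> : [forall y in Q, sple y x] = (#|tops x| == 0).
  apply/forall_inP/eqP => [H|/(tops_top xP)-> y yQ]; last exact/le_top/QB.
  apply/eqP; rewrite -leqn0 -card_tops_top.
  by apply/subset_leq_card/tops_anti; rewrite ?top_PiB ?H.
by move: (card_tops_le x); rewrite lt0n ltn_neqAle => ->; rewrite andbT andbC.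
Qed.
End BotTop.

Lemma dim_eq (k m : nat) : (k%:Z == m.+1%:Z - 2 + 1)%R = (k == m).
Proof. by apply/eqP/eqP; lia. Qed.

Lemma dim_eqS (k m : nat) : (k%:Z == m.+1%:Z - 2 + 1 + 1)%R = (k == m.+1).
Proof. by apply/eqP/eqP; lia. Qed.

(** * Facets of the order complex, their ranked elements and their records *)

Section Chains.
Variable m : nat.
Local Notation n := m.+1.
Implicit Types (x y t : blocks n) (u : sperm n) (C : {set blocks n}).

(** A facet for the whole of [PiB]; lying in a subposet is kept as a separate inclusion, so that
    facets of different subposets can be compared. *)
Definition mchain C := [&& C \subset [set x in PiB n | 0 < #|tops x| < n],
  [forall x in C, forall y in C, sple x y || sple y x] & #|C| == m].

Lemma mchain_PiB C x : mchain C -> x \in C -> x \in PiB n /\ 0 < #|tops x| < n.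
Proof. by case/and3P=> /subsetP H _ _ /H; rewrite inE => /andP[]. Qed.

Lemma chain_tops_inj C x y : C \subset PiB n ->
  [forall x in C, forall y in C, sple x y || sple y x] ->
  x \in C -> y \in C -> #|tops x| = #|tops y| -> x = y.
Proof.
move=> /subsetP CB /forall_inP H xC yC E.
have /forall_inP/(_ y yC)/orP[] := H x xC => le; [|symmetry];
  by apply: sple_tops_eq; rewrite ?CB // E.
Qed.

Lemma simplex_mchain (Q : {set blocks n}) C : Q \subset PiB n -> bot n \in Q -> top n \in Q ->
  simplex (@sple n) (proper_part (@sple n) Q) (n%:Z - 2) C = mchain C && (C \subset Q).
Proof.
move=> QB bQ tQ; apply/and3P/andP => [[/subsetP H1 H2 H3]|[/and3P[/subsetP H1 H2 H3] /subsetP H4]].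
  split; last by apply/subsetP=> x /H1; rewrite proper_partE // => /andP[].
  apply/and3P; split=> //; last by rewrite dim_eq in H3.
  apply/subsetP=> x /H1; rewrite proper_partE // inE => /andP[xQ ->].
  by rewrite (subsetP QB).
split=> //; last by rewrite dim_eq.
apply/subsetP=> x xC; rewrite proper_partE // H4 //.
by have := H1 _ xC; rewrite inE => /andP[].
Qed.

(** In a chain of the proper part the coranks are distinct and lie between 1 and n - 1, so n
    elements are too many. *)
Lemma no_simplex (Q : {set blocks n}) C : Q \subset PiB n -> bot n \in Q -> top n \in Q ->
  ~~ simplex (@sple n) (proper_part (@sple n) Q) (n%:Z - 2 + 1) C.
Proof.
move=> QB bQ tQ; apply/negP=> /and3P[/subsetP H1 H2 H3].
have CQ : C \subset PiB n.
  by apply/subsetP=> x /H1; rewrite proper_partE // => /andP[/(subsetP QB)].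
have inj : {in C &, injective (fun x => inord #|tops x| : 'I_n)}.
  move=> x y xC yC /(congr1 val); rewrite /= !inordK.
  - exact: (chain_tops_inj CQ H2).
  - by have := H1 _ yC; rewrite proper_partE // => /and3P[].
  - by have := H1 _ xC; rewrite proper_partE // => /and3P[].
have : [set (inord #|tops x| : 'I_n) | x in C] \subset [set~ ord0].
  apply/subsetP=> _ /imsetP[x xC ->]; have := H1 _ xC.
  rewrite proper_partE // => /and3P[_ h0 hn]; rewrite !inE; apply/eqP=> /(congr1 val).
  by rewrite /= inordK // => E; rewrite E in h0.
move/subset_leq_card; rewrite card_in_imset // cardsC1 card_ord.
by move: H3; rewrite dim_eqS => /eqP->; rewrite ltnn.
Qed.

(** The element of rank k, with bottom and top adjoined as ranks 0 and n; for a facet and 0 < k < n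
    the default is never reached ([at_in]). *)
Definition chain_at C k := if k == 0 then bot n else if k == n then top n
  else odflt (bot n) [pick x in C | #|tops x| == n - k].

Lemma at_in C k : mchain C -> 0 < k < n -> chain_at C k \in C /\ #|tops (chain_at C k)| = n - k.
Proof.
move=> mC /andP[k0 kn]; rewrite /chain_at (gtn_eqF k0) (ltn_eqF kn).
case: pickP => [x /andP[xC /eqP E]|no] //=.
have CB : C \subset PiB n by apply/subsetP=> x /(mchain_PiB mC)[].
have /and3P[_ H2 /eqP H3] := mC.
have inj : {in C &, injective (fun x => inord #|tops x| : 'I_n)}.
  move=> x y xC yC /(congr1 val); rewrite /= !inordK; first exact: (chain_tops_inj CB H2).
    by have [_ /andP[]] := mchain_PiB mC yC.
  by have [_ /andP[]] := mchain_PiB mC xC.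
have E : [set (inord #|tops x| : 'I_n) | x in C] = [set~ ord0].
  apply/eqP; rewrite eqEcard card_in_imset // cardsC1 card_ord H3 leqnn andbT.
  apply/subsetP=> _ /imsetP[x xC ->]; have [_ /andP[h0 hn]] := mchain_PiB mC xC.
  by rewrite !inE; apply/eqP=> /(congr1 val); rewrite /= inordK // => E; rewrite E in h0.
have : (inord (n - k) : 'I_n) \in [set~ ord0].
  by rewrite !inE; apply/eqP=> /(congr1 val); rewrite /= inordK; lia.
rewrite -E => /imsetP[x xC /(congr1 val)].
have [_ /andP[h0 hn]] := mchain_PiB mC xC.
rewrite /= !inordK //; last by lia.
by move=> Ex; have := no x; rewrite xC -Ex eqxx.
Qed.

Lemma at0 C : chain_at C 0 = bot n. Proof. by []. Qed.
Lemma atn C : chain_at C n = top n. Proof. by rewrite /chain_at eqxx. Qed.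

Lemma at_cases k : k <= n -> [\/ k = 0, k = n | 0 < k < n].
Proof.
move=> kn; have [->|h0] := posnP k; first by constructor 1.
move: kn; rewrite leq_eqVlt => /orP[/eqP->|h]; first by constructor 2.
by constructor 3.
Qed.

Lemma at_PiB C k : mchain C -> k <= n -> chain_at C k \in PiB n.
Proof.
move=> mC /at_cases[->|->|h]; rewrite ?atn ?top_PiB ?bot_PiB //.
by have [/(mchain_PiB mC)[]] := at_in mC h.
Qed.

Lemma at_tops C k : mchain C -> k <= n -> #|tops (chain_at C k)| = n - k.
Proof.
move=> mC /at_cases[->|->|h]; rewrite ?atn ?at0 ?card_tops_bot ?card_tops_top ?subnn ?subn0 //.
by have [] := at_in mC h.
Qed.

Lemma at_tops0 C k : mchain C -> k < n -> tops (chain_at C k) != set0.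
Proof. by move=> mC kn; rewrite -cards_eq0 at_tops //; lia. Qed.

Lemma at_le C j k : mchain C -> j <= k -> k <= n -> sple (chain_at C j) (chain_at C k).
Proof.
move=> mC jk kn; have jn := leq_trans jk kn.
have [->|j0|hj] := at_cases jn; first exact/bot_le/at_PiB.
  by have -> : k = n; [lia|rewrite atn le_top // at_PiB].
have [k0|->|hk] := at_cases kn; first by lia.
  by rewrite atn le_top // at_PiB.
have [jC Ej] := at_in mC hj; have [kC Ek] := at_in mC hk.
have /and3P[_ /forall_inP/(_ _ jC)/forall_inP/(_ _ kC)/orP[] // h _] := mC.
have := subset_leq_card (tops_anti (at_PiB mC kn) (at_PiB mC jn) h).
rewrite Ej Ek => le; have -> : j = k by lia.
exact/sple_refl/at_PiB.
Qed.

Lemma at_eq C x : mchain C -> x \in C -> x = chain_at C (n - #|tops x|).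
Proof.
move=> mC xC; have [xP /andP[h0 hn]] := mchain_PiB mC xC.
have h : 0 < n - #|tops x| < n by lia.
have [aC aE] := at_in mC h; have /and3P[_ H2 _] := mC.
apply: chain_tops_inj H2 _ _ _ => //; first by apply/subsetP=> y /(mchain_PiB mC)[].
by rewrite aE; lia.
Qed.

Lemma at_ext C C' : mchain C -> mchain C' ->
  (forall k, 0 < k < n -> chain_at C k = chain_at C' k) -> C = C'.
Proof.
suff W D D' : mchain D -> mchain D' -> (forall k, 0 < k < n -> chain_at D k = chain_at D' k) -> D \subset D'.
  by move=> mC mC' E; apply/eqP; rewrite eqEsubset !W // => k /E.
move=> mC mC' E; apply/subsetP=> x xC; rewrite (at_eq mC xC).
have [xP /andP[h0 hn]] := mchain_PiB mC xC.
by rewrite E; [have [] := @at_in D' (n - #|tops x|) mC' |]; lia.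
Qed.

Lemma at_uniq C (f : nat -> blocks n) : mchain C ->
  (forall k, 0 < k < n -> f k \in C /\ #|tops (f k)| = n - k) ->
  forall k, 0 < k < n -> chain_at C k = f k.
Proof.
move=> mC H k hk; have [fC fE] := H k hk.
by rewrite [RHS](at_eq mC fC) fE; congr chain_at; lia.
Qed.

Lemma mchain_replace C C' k y : mchain C -> mchain C' -> 0 < k < n ->
  y \in C' -> C' :\ y = C :\ chain_at C k -> C' != C ->
  [/\ forall j, j <= n -> j != k -> chain_at C' j = chain_at C j, chain_at C' k = y & y != chain_at C k].
Proof.
move=> mC mC' hk yC' E nC.
have A j : j <= n -> j != k -> chain_at C' j = chain_at C j.
  move=> /at_cases[-> //|->|h jk]; first by rewrite !atn.
  have [jC Ej] := at_in mC h; have [kC Ek] := at_in mC hk.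
  have : chain_at C j \in C' :\ y.
    by rewrite E !inE jC andbT; apply/eqP=> E'; move: Ej; rewrite E' Ek; lia.
  by rewrite !inE => /andP[_ h2]; rewrite [RHS](at_eq mC' h2) Ej; congr chain_at; lia.
have [yP /andP[h0 hn]] := mchain_PiB mC' yC'.
have Ey := at_eq mC' yC'.
have yk : n - #|tops y| = k.
  apply/eqP; apply: contraT => ne.
  have h : 0 < n - #|tops y| < n by lia.
  have := setD11 y C'; rewrite E !inE {2}Ey A // ?leq_subr //.
  have [aC aE] := at_in mC h; rewrite aC andbT => /negbFE/eqP E'.
  have [_] := at_in mC hk; rewrite -E'; move/andP: hk; lia.
rewrite yk in Ey; split=> //; apply: contra_neq nC => Eyk; apply: at_ext => // j hj.
have [->|jk] := eqVneq j k; first by rewrite -Ey.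
by apply: A => //; case/andP: hj => _ /ltnW.
Qed.

Definition step_value (x y : blocks n) : nat := if same y (Mx x) ord0 then 2 else changed x y.

Lemma step_value_le2 x y : step_value x y <= 2.
Proof. by rewrite /step_value; case: ifP => // _; case: changed. Qed.

Definition weight C := ternary (fun k => step_value (chain_at C k) (chain_at C k.+1)) n.

Lemma weight_replace C C' k y : mchain C -> mchain C' -> 0 < k < n ->
  y \in C' -> C' :\ y = C :\ chain_at C k -> C' != C ->
  step_value (chain_at C k.-1) (chain_at C k) < step_value (chain_at C k.-1) y -> weight C < weight C'.
Proof.
move=> mC mC' hk yC' E nC lt; have [A Ey _] := mchain_replace mC mC' hk yC' E nC.
have k0 : k.-1.+1 = k by lia.
apply: (@ternary_lt _ _ k.-1); first by move=> j; exact: step_value_le2.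
- by move=> j jk; rewrite !A //; lia.
- by rewrite k0 Ey A //; lia.
by lia.
Qed.

(** Take the last step that does not change the block of the greatest letter, and exchange its upper
    end. By [unchanged_eq] any other choice there changes that block, which raises the first digit
    affected. *)
Lemma noncritical C : mchain C -> (exists2 k, k < n & step_value (chain_at C k) (chain_at C k.+1) = 0) ->
  exists2 k, 0 < k < n & forall C' y, mchain C' -> y \in C' -> C' :\ y = C :\ chain_at C k ->
    C' != C -> weight C < weight C'.
Proof.
move=> mC [k0 k0n E0].
have ex : exists k, (k < n) && (step_value (chain_at C k) (chain_at C k.+1) == 0) by exists k0; rewrite k0n E0.
have ub k : (k < n) && (step_value (chain_at C k) (chain_at C k.+1) == 0) -> k <= n by case/andP=> /ltnW.
have [k /andP[kn /eqP sk] kmax] := ex_maxnP ex ub.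
(* The last step of a facet sends the greatest letter to zero, so its digit is 2 and rank k + 1 is
   proper. *)
have km : k < m.
  rewrite ltn_neqAle -ltnS kn andbT; apply/eqP=> Ek; move: sk; rewrite Ek.
  by rewrite /step_value atn same_top.
exists k.+1; first by rewrite /= ltnS.
move=> C' y mC' yC' E nC; apply: (weight_replace mC mC' _ yC' E nC); first by rewrite /= ltnS.
rewrite /= sk lt0n; apply/eqP=> sy.
have hk : 0 < k.+1 < n by rewrite /= ltnS.
have [A Ey /eqP ny] := mchain_replace mC mC' hk yC' E nC; apply: ny.
have yP : y \in PiB n by have [] := mchain_PiB mC' yC'.
have sk2 : step_value (chain_at C k.+1) (chain_at C k.+2) != 0.
  by apply/eqP=> E2; have := kmax k.+1; rewrite E2 ltnS km ltnn => /(_ isT).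
have st0 x t : step_value x t = 0 -> ~~ changed x t by rewrite /step_value; case: ifP => // _; case: changed.
have kP : chain_at C k \in PiB n by apply: at_PiB => //; (move: km; clear; lia).
have k1P : chain_at C k.+1 \in PiB n by apply: at_PiB => //; (move: km; clear; lia).
have k2P : chain_at C k.+2 \in PiB n by apply: at_PiB => //; (move: km; clear; lia).
have k0' : tops (chain_at C k) != set0 by apply: at_tops0.
have k1' : tops (chain_at C k.+1) != set0 by apply: at_tops0 => //; (move: km; clear; lia).
have le01 : sple (chain_at C k) (chain_at C k.+1) by apply: at_le => //; (move: km; clear; lia).
have le12 : sple (chain_at C k.+1) (chain_at C k.+2) by apply: at_le => //; (move: km; clear; lia).
have Ak : chain_at C' k = chain_at C k by apply: A; (move: km; clear; lia).
have Ak2 : chain_at C' k.+2 = chain_at C k.+2 by apply: A; (move: km; clear; lia).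
have le0y : sple (chain_at C k) y by rewrite -Ey -Ak; apply: at_le => //; (move: km; clear; lia).
have ley2 : sple y (chain_at C k.+2) by rewrite -Ey -Ak2; apply: at_le => //; (move: km; clear; lia).
apply: (unchanged_eq kP k1P yP k2P k0' le01 le0y le12 ley2).
- by rewrite !at_tops //; (move: km; clear; lia).
- by rewrite -Ey !at_tops //; (move: km; clear; lia).
- exact: st0.
- exact: st0.
move: sk2; rewrite /step_value; case: ifP => [z _|_]; last by case: changed.
exact: changed_zero.
Qed.

End Chains.

(** * The facet of a signed permutation *)

Section Groups.
Variables (m : nat) (B : pred 'I_m.+1).
Hypothesis Bmax : B ord_max.
Local Notation n := m.+1.
Implicit Types p q k l : 'I_n.

(* B marks the last positions of consecutive groups; gend p and gstart p are
   the last and the first position of the group of p. *)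
Definition gend p : 'I_n := [arg min_(q < ord_max | (p <= q) && B q) val q].
Definition gstart p : 'I_n :=
  [arg min_(l < p | [forall k : 'I_n, (l <= k < p) ==> ~~ B k]) val l].

Lemma gendP p : [/\ p <= gend p, B (gend p) & forall k, p <= k -> k < gend p -> ~~ B k].
Proof.
rewrite /gend; case: arg_minnP => [|q /andP[pq Bq] qmin]; first by rewrite leq_ord.
split=> // k pk; apply: contraTN => Bk; rewrite -leqNgt; apply: qmin.
by rewrite pk.
Qed.

Lemma gstartP p : [/\ gstart p <= p, forall k, gstart p <= k -> k < p -> ~~ B k &
  forall k, k < gstart p -> exists2 q : 'I_n, k <= q < gstart p & B q].
Proof.
rewrite /gstart; case: arg_minnP => [|l /forallP H lmin].
  by apply/forallP=> k; apply/implyP; lia.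
have lp : l <= p by apply: lmin; apply/forallP=> k; apply/implyP; lia.
split=> // [k lk kp|k kl]; first by have /implyP := H k; rewrite lk; apply.
have [/existsP[q /andP[h Bq]]|] := boolP [exists q : 'I_n, (k <= q < p) && B q].
  exists q => //; case/andP: h => -> qp /=; rewrite ltnNge; apply/negP=> lq.
  by have /implyP/(_ _)/negP := H q; rewrite lq qp; apply.
rewrite negb_exists => /forallP no; suff : l <= k by lia.
apply: lmin; apply/forallP=> q; apply/implyP=> h; have := no q; by rewrite h.
Qed.

Lemma gend_uniq p q : p <= q -> B q -> (forall k, p <= k -> k < q -> ~~ B k) -> gend p = q.
Proof.
move=> pq Bq H; have [h1 h2 h3] := gendP p; apply/val_inj/eqP => /=.
have [lt|lt|//] := ltngtP (gend p) q.
  by have := H _ h1 lt; rewrite h2.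
by have := h3 _ pq lt; rewrite Bq.
Qed.

Lemma gstart_uniq p l : l <= p -> (forall k, l <= k -> k < p -> ~~ B k) ->
  (forall k, k < l -> exists2 q : 'I_n, k <= q < l & B q) -> gstart p = l.
Proof.
move=> lp H1 H2; have [h1 h2 h3] := gstartP p; apply/val_inj/eqP => /=.
have [lt|lt|//] := ltngtP (gstart p) l.
  have [q /andP[a b] Bq] := H2 _ lt; by have := h2 q a (leq_trans b lp); rewrite Bq.
have [q /andP[a b] Bq] := h3 _ lt; by have := H1 q a (leq_trans b h1); rewrite Bq.
Qed.

Lemma group_inner p k : gstart p <= k -> k < gend p -> ~~ B k.
Proof.
have [_ _ a3] := gendP p; have [_ b2 _] := gstartP p.
by move=> c1 c2; have [lt|ge] := ltnP k p; [apply: b2|apply: a3].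
Qed.

Lemma group_eq p k : gstart p <= k -> k <= gend p -> gstart k = gstart p /\ gend k = gend p.
Proof.
move=> h1 h2; have [a1 a2 a3] := gendP p; have [b1 b2 b3] := gstartP p.
split.
  apply: gstart_uniq => // q c1 c2; apply: (@group_inner p) => //; exact: leq_trans h2.
apply: gend_uniq => // q c1 c2; apply: (@group_inner p) => //; exact: leq_trans h1 c1.
Qed.

Lemma gstart_lt p q : B q -> q < p -> q < gstart p.
Proof.
move=> Bq qp; rewrite ltnNge; apply/negP=> le; have [_ h _] := gstartP p.
by have := h q le qp; rewrite Bq.
Qed.

Lemma gend_le p q : B q -> p <= q -> gend p <= q.
Proof.
move=> Bq pq; rewrite leqNgt; apply/negP=> lt; have [_ _ h] := gendP p.
by have := h q pq lt; rewrite Bq.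
Qed.

Lemma gend_id q : B q -> gend q = q.
Proof. by move=> Bq; apply: gend_uniq => // k; lia. Qed.

(** Reverses each group in place: a facet imposes the adjacencies of a group from its last position
    to its first. *)
Definition grev_fun p : 'I_n := inord (gstart p + gend p - p).

Lemma grev_funE p : grev_fun p = gstart p + gend p - p :> nat.
Proof.
have [a1 _ _] := gendP p; have [b1 _ _] := gstartP p; rewrite inordK //.
by have := ltn_ord (gend p); move: a1 b1; clear; lia.
Qed.

Lemma grev_fun_bounds p : gstart p <= grev_fun p <= gend p.
Proof.
have [a1 _ _] := gendP p; have [b1 _ _] := gstartP p; rewrite grev_funE.
by move: a1 b1; clear; lia.
Qed.

Lemma grev_funK : involutive grev_fun.
Proof.
move=> p; apply: val_inj => /=; rewrite grev_funE.
have /andP[h1 h2] := grev_fun_bounds p; have [-> ->] := group_eq h1 h2.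
rewrite grev_funE; have [a1 _ _] := gendP p; have [b1 _ _] := gstartP p.
by move: a1 b1; clear; lia.
Qed.

Definition grev : 'S_n := perm (can_inj grev_funK).

Lemma grevE p : grev p = gstart p + gend p - p :> nat.
Proof. by rewrite permE grev_funE. Qed.

Lemma grev_bounds p : gstart p <= grev p <= gend p.
Proof. by rewrite permE grev_fun_bounds. Qed.

End Groups.

Lemma grev_ext m (B B' : pred 'I_m.+1) (h : B ord_max) (h' : B' ord_max) :
  B =1 B' -> grev h =1 grev h'.
Proof.
move=> E p; apply: val_inj; rewrite /= !grevE.
have [a1 a2 a3] := gendP h' p; have [b1 b2 b3] := gstartP h' p.
have -> : gend B p = gend B' p.
  by apply: gend_uniq; rewrite ?E // => k h1 h2; rewrite E a3.
suff -> : gstart B p = gstart B' p by [].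
apply: gstart_uniq => // [k h1 h2|k /b3[q]]; first by rewrite E b2.
by exists q; rewrite ?E.
Qed.

Section BooleanChains.
Variable m : nat.
Local Notation n := m.+1.

Lemma card_ord_ge (s : 'S_n) k : k <= n -> #|[set p | k <= s p]| = n - k.
Proof.
move=> kn; rewrite -[n in RHS]card_ord -(cardsC [set p | k <= s p]).
suff -> : #|~: [set p | k <= s p]| = k by rewrite addnK.
rewrite -(card_preimset _ (@perm_inj _ (s^-1)%g)) -[RHS]card_ord.
have inj : injective (widen_ord kn) by move=> i j /(congr1 val) /= /val_inj.
rewrite -(card_imset (pred_of_simpl predT) inj); apply: eq_card => p.
rewrite !inE permKV -ltnNge; apply/idP/imsetP => [pk|[i _ ->]]; last exact: ltn_ord i.
by exists (Ordinal pk) => //; apply: val_inj.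
Qed.

Variables (g : {set 'I_n} -> blocks n).
Hypothesis gle : forall S S', sple (g S) (g S') = (S' \subset S).
Hypothesis gB : forall S, g S \in PiB n.
Hypothesis gtops : forall S, #|tops (g S)| = #|S|.

Lemma bchain_mchain s : mchain (bchain g s).
Proof.
apply/and3P; split.
- apply/subsetP=> _ /imsetP[j _ ->]; have := ltn_ord j.
  by rewrite inE gB gtops card_ord_ge //=; [clear; lia|exact: leqW].
- apply/forall_inP=> _ /imsetP[j _ ->]; apply/forall_inP=> _ /imsetP[k _ ->].
  by rewrite !gle !bset_sub // leq_total.
by rewrite card_imset ?card_ord //; exact: gbset_inj.
Qed.

Lemma at_bchain s k : 0 < k < n -> chain_at (bchain g s) k = g [set p | k <= s p].
Proof.
move: k; apply: at_uniq (bchain_mchain s) _ => k /andP[k0 kn].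
rewrite gtops card_ord_ge ?(ltnW kn) //; split=> //.
have km : k.-1 < m by lia.
by apply/imsetP; exists (Ordinal km) => //; rewrite /bset /= prednK.
Qed.

End BooleanChains.

Section Fchain.
Variable m : nat.
Local Notation n := m.+1.
Implicit Types (u v : sperm n) (p q : 'I_n).

Lemma rl_max_last u : rl_max u ord_max.
Proof. by apply/forallP=> j; apply/implyP; rewrite ltnNge -ltnS ltn_ord. Qed.

(** [crev u p] is the step at which the adjacency at p is imposed. The first position of a group
    comes last in it: that adjacency sends the group to zero. *)
Definition crev u : 'S_n := grev (rl_max_last u).
Definition cend u p := gend (rl_max u) p.
Definition cstart u p := gstart (rl_max u) p.

Lemma rl_max_end u p q : p <= q -> u.1 q <= u.1 (cend u p).
Proof.
move=> pq; have [a1 a2 a3] := gendP (rl_max_last u) p.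
have [k pk kmax] := @arg_maxnP _ p (fun k : 'I_n => p <= k) (fun k => val (u.1 k)) (leqnn _).
have Bk : rl_max u k.
  apply/forallP=> j; apply/implyP=> kj.
  have /= := kmax j (leq_trans pk (ltnW kj)); rewrite leq_eqVlt => /orP[/eqP/val_inj/perm_inj E|//].
  by rewrite E ltnn in kj.
have := gend_le (rl_max_last u) Bk pk; rewrite leq_eqVlt => /orP[/eqP/val_inj E|lt].
  by rewrite /cend E; exact: kmax.
have /forallP/(_ k)/implyP/(_ lt) := a2; have /= := kmax (gend (rl_max u) p) a1.
by rewrite /= leqNgt => /negP.
Qed.

Definition sset u k := [set p | k <= crev u p].
Definition fchain u := bchain (@split_at n u) (crev u).

Lemma fchain_mchain u : mchain (fchain u).
Proof.
apply: bchain_mchain => *; [exact: split_le|exact: split_PiB|exact: card_tops_split].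
Qed.

Lemma at_fchain u k : k <= n -> chain_at (fchain u) k = split_at u (sset u k).
Proof.
move/at_cases=> [->|->|h].
- rewrite at0 (_ : sset u 0 = setT) ?split_setT //; by apply/setP=> p; rewrite !inE.
- rewrite atn (_ : sset u n = set0) ?split_set0 //.
  by apply/setP=> p; rewrite !inE leqNgt ltn_ord.
apply: at_bchain => // *; [exact: split_le|exact: split_PiB|exact: card_tops_split].
Qed.

Lemma card_sset u k : k <= n -> #|sset u k| = n - k.
Proof. exact: card_ord_ge. Qed.

(** By [rl_max_end], the summand at p is the greatest value from position p on. *)
Definition hgt u := \sum_(p < n) u.1 (cend u p).

Lemma same_split u S (i j : 'I_n) :
  same (split_at u S) (lift ord0 (u.1 i)) (lift ord0 (u.1 j)) = (cuts S i.+1 == cuts S j.+1).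
Proof. by rewrite /same -(split_lblock_eq u) // !wdS. Qed.

Lemma same_split_zero u S (i : 'I_n) :
  same (split_at u S) (lift ord0 (u.1 i)) ord0 = (cuts S i.+1 == 0).
Proof. by rewrite -(split_srel0 u) // wdS srel0 ?split_PiB. Qed.

Lemma zero_sset u q i : rl_max u q -> i <= q -> cuts (sset u q.+1) i.+1 = 0.
Proof.
move=> Bq iq; apply/eqP/cuts0 => s; rewrite inE => h; rewrite ltnNge; apply/negP=> si.
have /andP[_ h2] := grev_bounds (rl_max_last u) s.
have := gend_le (rl_max_last u) Bq (leq_trans si iq).
by move: h h2; rewrite /crev; lia.
Qed.

(** * Triangularity of the cycles on the selected facets *)

Section Triangular.
Variables (u u' : sperm n) (e : nat).
(** In type B, e = 0 and v is [u']. In type D, e = 1, and v is [u'] or its first-sign flip, a choice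
    that may vary with k. *)
Hypothesis sub : forall k, 0 < k < n -> exists v S,
  [/\ chain_at (fchain u) k = split_at v S, v.1 = u'.1 & forall p, e <= p -> v.2 p = u'.2 p].

Lemma sub_all k : k <= n -> exists v S,
  [/\ split_at u (sset u k) = split_at v S, v.1 = u'.1, #|S| = n - k &
      forall p, e <= p -> v.2 p = u'.2 p].
Proof.
move=> kn; rewrite -at_fchain //.
suff [v [S [E1 E2 E3]]] : exists v S,
  [/\ chain_at (fchain u) k = split_at v S, v.1 = u'.1 & forall p, e <= p -> v.2 p = u'.2 p].
  exists v, S; split=> //; rewrite -(card_tops_split v) -E1 at_tops //.
  exact: fchain_mchain.
have [->|->|/sub//] := at_cases kn.
  by exists u', setT; rewrite split_setT.
by exists u', set0; rewrite split_set0 atn.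
Qed.

(** All n - k cuts must lie beyond r, where only n - r - 1 positions are available. *)
Lemma zero_pos k r : k <= n ->
  same (split_at u (sset u k)) (lift ord0 (u'.1 r)) ord0 -> r < k.
Proof.
move=> kn; have [v [S [-> Ev cS _]]] := sub_all kn.
rewrite -Ev same_split_zero => /cuts0 H.
have : #|S| <= #|[set p : 'I_n | r.+1 <= (1%g : 'S_n) p]|.
  by apply/subset_leq_card/subsetP=> s /H; rewrite inE perm1.
by rewrite card_ord_ge ?ltn_ord // cS; have := ltn_ord r; move: kn; clear; lia.
Qed.

(** A greater suffix maximum of [u'] would be a letter of an earlier group of [u], hence zero once
    that group, ending at some q < p, is finished; [zero_pos] would then place it before p in
    [u']. *)
Lemma cend_le p : u'.1 (cend u' p) <= u.1 (cend u p).
Proof.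
rewrite leqNgt; apply/negP=> lt; set r := cend u' p in lt.
have [pr _ _] := gendP (rl_max_last u') p.
pose i := (u.1^-1)%g (u'.1 r); have Ei : u.1 i = u'.1 r by rewrite permKV.
have ip : i < p.
  by rewrite ltnNge; apply/negP=> /(rl_max_end u); rewrite Ei leqNgt lt.
have il : i < cstart u p.
  rewrite ltnNge; apply/negP=> li; have [pe _ _] := gendP (rl_max_last u) p.
  have [_ E] := group_eq (rl_max_last u) li (leq_trans (ltnW ip) pe).
  by have := rl_max_end u (leqnn i); rewrite /cend E Ei leqNgt lt.
have [lp _ /(_ _ il)[q /andP[iq ql] Bq]] := gstartP (rl_max_last u) p.
have := @zero_pos q.+1 r (ltn_ord q).
rewrite -Ei same_split_zero zero_sset // => /(_ isT).
by rewrite /r /cend; move: pr lp ql; clear; lia.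
Qed.

Lemma hgt_le : hgt u' <= hgt u.
Proof. by apply: leq_sum => p _; exact: cend_le. Qed.

Hypothesis heq : hgt u' = hgt u.
Hypotheses (ru : rl_max_unbarred u) (ru' : rl_max_unbarred u').

Lemma cend_eq p : u'.1 (cend u' p) = u.1 (cend u p).
Proof.
apply/val_inj/eqP => /=; rewrite eqn_leq cend_le leqNgt; apply/negP=> lt.
move: heq; rewrite /hgt (bigD1 p) //= [RHS](bigD1 p) //= => E.
have : \sum_(i < n | i != p) u'.1 (cend u' i) <= \sum_(i < n | i != p) u.1 (cend u i).
  by apply: leq_sum => i _; exact: cend_le.
by move=> h; have := leq_add lt h; rewrite addSn E ltnn.
Qed.

Lemma rl_pos q : rl_max u q -> u'.1 q = u.1 q /\ rl_max u' q.
Proof.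
move=> Bq; have E := cend_eq q.
have Eq : cend u q = q by apply: gend_id Bq; exact: rl_max_last.
rewrite Eq in E; have [qr Br _] := gendP (rl_max_last u') q; rewrite -/(cend u' q) in qr Br.
have := @zero_pos q.+1 (cend u' q) (ltn_ord q); rewrite E same_split_zero zero_sset // => /(_ isT).
rewrite ltnS => rq; have Er : cend u' q = q by apply/val_inj/eqP; rewrite /= eqn_leq rq qr.
by rewrite Er in E Br.
Qed.

(** Induction on the distance from p to the end of its group, where values agree by [rl_pos] and
    both signs are unbarred. *)
Lemma perm_pos p : u'.1 p = u.1 p /\ (e <= p -> u'.2 p = u.2 p).
Proof.
have [d] := ubnP (cend u p - p); elim: d p => // d IH p; rewrite ltnS => ltd.
have [pq Bq _] := gendP (rl_max_last u) p; have [lp _ _] := gstartP (rl_max_last u) p.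
rewrite -/(cend u p) -/(cstart u p) in pq Bq lp.
move: pq; rewrite leq_eqVlt => /orP[/eqP/val_inj Epq|lt].
  rewrite -Epq in Bq; have [E B'] := rl_pos Bq; split=> // _.
  by rewrite (negbTE (implyP (forallP ru p) Bq)) (negbTE (implyP (forallP ru' p) B')).
set q := cend u p in ltd Bq lt; set l := cstart u p in lp.
have G (i : 'I_n) : p <= i -> i <= q -> cstart u i = l /\ cend u i = q.
  by move=> pi iq; apply: (group_eq (rl_max_last u)) => //; exact: leq_trans pi.
have IH' (i : 'I_n) : p < i -> i <= q -> u'.1 i = u.1 i /\ (e <= i -> u'.2 i = u.2 i).
  move=> pi iq; apply: IH; have [_ ->] := G i (ltnW pi) iq.
  by move: ltd pi lt iq; rewrite -/q; clear; lia.
(* At rank j the adjacencies at p + 1, ..., q are imposed and that at p is not yet: positions p to q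
   of [u] form one nonzero block. *)
pose j := crev u p; have Ej : j = l + q - p :> nat by rewrite /j /crev grevE.
have [v [S [Ex Ev cS Es]]] := sub_all (ltnW (ltn_ord j)).
set x := split_at u _ in Ex.
have xP : x \in PiB n by exact: split_PiB.
have cutN (s : 'I_n) : p < s -> s <= q -> s \notin sset u j.
  move=> ps sq; rewrite inE -ltnNge Ej grevE -/(cstart u s) -/(cend u s).
  by have [-> ->] := G s (ltnW ps) sq; move: ps sq lp; clear; lia.
have cutp : p \in sset u j by rewrite inE.
have cutq (s : 'I_n) : q < s -> s \in sset u j.
  move=> qs; rewrite inE; have /andP[h _] := grev_bounds (rl_max_last u) s.
  have := gstart_lt (rl_max_last u) Bq qs.
  by move: h lp lt; rewrite Ej /crev; clear; lia.
have sameU i k : same x (lift ord0 (u.1 i)) (lift ord0 (u.1 k)) = (cuts (sset u j) i.+1 == cuts (sset u j) k.+1).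
  exact: same_split.
have sameV i k : same x (lift ord0 (u'.1 i)) (lift ord0 (u'.1 k)) = (cuts S i.+1 == cuts S k.+1).
  by rewrite Ex -Ev same_split.
have inG (r' : 'I_n) : same x (lift ord0 (u.1 r')) (lift ord0 (u.1 q)) -> p <= r' <= q.
  rewrite sameU => h; apply/andP; split; rewrite leqNgt; apply/negP=> c.
    have /cuts_eqP/(_ p cutp c) := h; rewrite ltnS (leq_trans (ltnW c) (ltnW lt)) => /(_ isT).
    by rewrite leqNgt ltnW.
  have hq : q.+1 < n by apply: leq_ltn_trans (ltn_ord r').
  rewrite eq_sym in h; have /cuts_eqP/(_ (Ordinal hq)) := h => /=.
  rewrite cutq //= ltnS ltnW // => /(_ isT isT (leqnn _)).
  by rewrite ltnS leqNgt c.
have pqs : same x (lift ord0 (u.1 p)) (lift ord0 (u.1 q)).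
  rewrite sameU; apply/cuts_eqP; first by rewrite ltnS ltnW.
  move=> s sS ps; rewrite ltnNge; apply/negP=> sq.
  by have := cutN s ps sq; rewrite sS.
have nzp : ~~ same x (lift ord0 (u.1 p)) ord0.
  by rewrite same_split_zero; apply/cuts0=> /(_ p cutp); rewrite ltnn.
have [Eq' _] := IH' q lt (leqnn _).
pose r := (u'.1^-1)%g (u.1 p); have Er : u'.1 r = u.1 p by rewrite permKV.
have rq : r <= q.
  rewrite -ltnS; apply: zero_pos; first exact: ltn_ord.
  by rewrite Er same_split_zero zero_sset // ltnW.
have rp : r <= p.
  rewrite leqNgt; apply/negP=> pr; have [Err _] := IH' r pr rq.
  by move: Err; rewrite Er => /perm_inj Epr; rewrite Epr ltnn in pr.
(* If r < p, the letter of [u'] at p lies in this block too, since blocks of a splitting are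
   intervals; but all letters of the block already have other positions in [u']. *)
have Erp : r = p.
  apply/eqP; apply: contraT => nrp.
  have ltrp : r < p by rewrite ltn_neqAle rp andbT.
  have : same x (lift ord0 (u'.1 p)) (lift ord0 (u'.1 q)).
    move: pqs; rewrite -Er -Eq' !sameV => /eqP h.
    rewrite eqn_leq cuts_mono; last by rewrite ltnS ltnW.
    by rewrite -h cuts_mono // ltnS ltnW.
  pose r' := (u.1^-1)%g (u'.1 p); have Er' : u.1 r' = u'.1 p by rewrite permKV.
  rewrite -Er' Eq' => /inG/andP[]; rewrite leq_eqVlt => /orP[/eqP/val_inj E|pr' r'q].
    by move: Er'; rewrite -E -Er => /perm_inj E'; rewrite E' eqxx in nrp.
  have [E _] := IH' r' pr' r'q; move: E; rewrite Er' => /perm_inj E.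
  by rewrite E ltnn in pr'.
have Ep : u'.1 p = u.1 p by rewrite -Er Erp.
split=> // ep.
have p1n : p.+1 < n by apply: leq_trans (ltn_ord q); rewrite ltnS.
pose p1 := Ordinal p1n.
have [Ep1 /(_ (leqW ep)) Es1] := IH' p1 (leqnn _) lt.
have Rv : srel x (wd v p.+1) (wd v p1.+1).
  rewrite Ex split_srel // -sameV Ep Ep1 sameU; apply/cuts_eqP => // s sS ps.
  rewrite ltn_neqAle ps andbT; apply/eqP=> E.
  by have := cutN s; rewrite sS -E /= ltnSn lt => /(_ isT isT).
have Ru : srel x (wd u p.+1) (wd u p1.+1).
  rewrite split_srel //; apply/cuts_eqP => // s sS ps.
  rewrite ltn_neqAle ps andbT; apply/eqP=> E.
  by have := cutN s; rewrite sS -E /= ltnSn lt => /(_ isT isT).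
have V1 : wd v p1.+1 = wd u p1.+1 by rewrite !wdS Ev Ep1 Es ?Es1 // leqW.
(* With opposite signs, the letter and its bar would both be related to the next letter, putting a
   nonzero block into the zero class. *)
apply/eqP; apply: contraT => ne.
have V0 : wd v p.+1 = sbar (wd u p.+1).
  rewrite !wdS Ev Ep Es // /sbar /letter /=; congr pair.
  by move: ne; case: (u'.2 p); case: (u.2 p).
rewrite V0 V1 in Rv; have := srel_bar_same0 xP Ru Rv; rewrite wdS => h.
by rewrite h in nzp.
Qed.

End Triangular.

End Fchain.

(** * Critical facets *)

Section Critical.
Variables (m : nat) (C : {set blocks m.+1}).
Local Notation n := m.+1.
Hypothesis mC : mchain C.
Hypothesis crit : forall k, k < n -> changed (chain_at C k) (chain_at C k.+1).

Local Notation x k := (chain_at C k).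
Local Notation M k := (Mx (chain_at C k)).

Lemma crit_PiB k : k <= n -> x k \in PiB n. Proof. exact: at_PiB. Qed.

Lemma crit_le j k : j <= k -> k <= n -> sple (x j) (x k). Proof. exact: at_le. Qed.

Lemma crit_same j k a b : j <= k -> k <= n -> same (x j) a b -> same (x k) a b.
Proof. by move=> jk kn; apply: sple_same (crit_le jk kn); apply: crit_PiB => //; exact: leq_trans kn. Qed.

Lemma crit_srel j k a b : j <= k -> k <= n -> srel (x j) a b -> srel (x k) a b.
Proof. by move=> jk kn; apply: sple_srel (crit_le jk kn); apply: crit_PiB => //; exact: leq_trans kn. Qed.

Lemma crit_tops0 k : k < n -> tops (x k) != set0. Proof. exact: at_tops0. Qed.

Lemma M_tops k : k < n -> M k \in tops (x k).
Proof. by move/crit_tops0/Mx_tops. Qed.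

Lemma M_nz k : k < n -> ~~ same (x k) (M k) ord0.
Proof. by move/M_tops/tops_nz. Qed.

Lemma M_next k : k < n -> ~~ same (x k.+1) (M k) ord0 -> M k.+1 = M k.
Proof.
move=> kn nz.
by have [] := Mx_eq (crit_PiB (ltnW kn)) (crit_PiB kn) (crit_le (leqnSn k) kn) (crit_tops0 kn) nz.
Qed.

Lemma crit_outside k a b : k < n -> ~~ same (x k) a (M k) -> ~~ same (x k) b (M k) ->
  same (x k.+1) a b -> same (x k) a b.
Proof.
move=> kn ha hb.
have card : #|tops (x k)| = #|tops (x k.+1)|.+1.
  by rewrite !at_tops ?(ltnW kn) //; move: kn; clear; lia.
have O s : srel (x k.+1) (a, s) (b, false) -> srel (x k) (a, s) (b, false).
  by apply: (srel_outside (crit_PiB (ltnW kn)) (crit_PiB kn) (crit_le (leqnSn k) kn) card (crit kn)).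
case/(@same_srel _ (x k.+1) (a, false) (b, false)) => h.
  exact: srel_same (O false h).
exact: srel_same (O true h).
Qed.

Lemma tops_bot_all : tops (bot n) = [set~ ord0].
Proof.
apply/eqP; rewrite eqEcard card_tops_bot cardsC1 card_ord leqnn andbT.
apply/subsetP=> a /tops_nz; rewrite !inE; apply: contraNneq => ->; by rewrite /same.
Qed.

(* Along a critical chain only the block of the greatest nonzero letter grows. *)
Lemma crit_single k a b : k < n -> ~~ same (x k) a ord0 -> ~~ same (x k) a (M k) ->
  same (x k) a b -> b = a.
Proof.
elim: k a b => [|k IH] a b kn nza nM ab.
  have N c : ~~ same (x 0) c ord0 -> c \in tops (x 0).
    by move=> h; rewrite at0 tops_bot_all !inE; apply: contraNneq h => ->; rewrite /same.
  apply/esym/(tops_uniq (N a nza) (N b _) ab).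
  by apply: contra nza; exact: same_trans.
have kn' : k < n by exact: ltnW.
have nk c : same (x k.+1) a c -> ~~ same (x k) c (M k).
  move=> ac; apply/negP=> /(crit_same (leqnSn k) (ltnW kn)) h.
  have aM := same_trans ac h.
  have [z|nz] := boolP (same (x k.+1) (M k) ord0); first by rewrite (same_trans aM z) in nza.
  by rewrite (M_next kn' nz) aM in nM.
have ka : ~~ same (x k) a (M k) by apply: nk; rewrite /same.
apply: (IH a b) => //; first by apply: contra nza; apply: crit_same => //; exact: ltnW.
exact: crit_outside kn' ka (nk b ab) ab.
Qed.

(** By [crit_single], these letters are still alone in nonzero blocks; exactly one leaves at each
    step. *)
Definition trem k := tops (x k) :\ M k.

Lemma card_trem k : k < n -> #|trem k|.+1 = n - k.
Proof.
by move=> kn; rewrite -(at_tops mC (ltnW kn)) [RHS](cardsD1 (M k)) M_tops.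
Qed.

Lemma trem_sub j k : j <= k -> k < n -> trem k \subset trem j.
Proof.
move=> jk; elim: k jk => [|k IH]; first by rewrite leqn0 => /eqP->.
rewrite leq_eqVlt => /orP[/eqP-> //|jk] kn; apply: subset_trans (IH jk (ltnW kn)).
apply/subsetP=> a /setD1P[aM aT].
have aTk : a \in tops (x k).
  by apply: subsetP aT; apply: tops_anti (crit_le (leqnSn k) (ltnW kn)); apply: crit_PiB; lia.
apply/setD1P; split=> //; apply: contra_neq aM => E.
by rewrite M_next ?(ltnW kn) // -E tops_nz.
Qed.

(** The rank from which [a] is no longer waiting: it is then the greatest nonzero letter or has been
    absorbed. [ord_max] qualifies as default since [trem m] is empty. *)
Definition idx (a : 'I_n) : 'I_n := [arg min_(k < ord_max | lift ord0 a \notin trem k) val k].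

Lemma trem_last : trem m = set0.
Proof. by apply/eqP; rewrite -cards_eq0 -eqSS card_trem // subSnn. Qed.

Lemma idxP (a : 'I_n) k : k < n -> (lift ord0 a \in trem k) = (k < idx a).
Proof.
move=> kn; rewrite /idx; case: arg_minnP => [|i ai imin]; first by rewrite trem_last inE.
apply/idP/idP => [ak|].
  rewrite ltnNge; apply: contra ai => ik.
  exact: subsetP (trem_sub ik kn) _ ak.
by apply: contraTT => ak; rewrite -leqNgt; apply: (imin (Ordinal kn)).
Qed.

Lemma lift0_inj (a b : 'I_n) : lift ord0 a = lift ord0 b -> a = b.
Proof. exact: lift_inj. Qed.

Lemma idx_inj : injective idx.
Proof.
move=> a b E; apply: lift0_inj.
(* [A] is the set of letters that stop waiting at rank [idx a]; at rank 0 this is the greatest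
   letter alone. *)
have [A [A1 aA bA]] : exists A : {set 'I_n.+1}, [/\ #|A| <= 1, lift ord0 a \in A & lift ord0 b \in A].
  have Ia := idxP a (ltn_ord (idx a)); have Ib := idxP b (ltn_ord (idx a)).
  rewrite ltnn in Ia; rewrite -E ltnn in Ib.
  case k0: (val (idx a)) => [|k]; rewrite k0 in Ia Ib.
    exists ([set~ ord0] :\: trem 0); split; [|by rewrite in_setD Ia in_setC1|by rewrite in_setD Ib in_setC1].
    have c0 := card_trem (ltn0Sn m).
    have sub0 : trem 0 \subset [set~ ord0].
      by apply/subsetP=> c /setD1P[_ /tops_nz]; rewrite !inE; apply: contraNneq => ->; rewrite /same.
    by rewrite (cardsDS sub0) cardsC1 card_ord; case: c0 => ->; rewrite subSnn.
  have kn : k < n by have := ltn_ord (idx a); rewrite [nat_of_ord _]k0 => /ltnW.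
  exists (trem k :\: trem k.+1); split.
  - have k1n : k.+1 < n by have := ltn_ord (idx a); rewrite [nat_of_ord _]k0.
    rewrite (cardsDS (trem_sub (leqnSn k) k1n)); have := card_trem k1n; have := card_trem kn.
    by move: #|trem k| #|trem k.+1| k1n; clear; lia.
  - by rewrite in_setD Ia idxP // [nat_of_ord _]k0 ltnSn.
  - by rewrite in_setD Ib idxP // -E [nat_of_ord _]k0 ltnSn.
by apply: (card_le1_eqP A1).
Qed.

Lemma idx_le (a : 'I_n) k : k < n -> idx a <= k ->
  same (x k) (lift ord0 a) ord0 || same (x k) (lift ord0 a) (M k).
Proof.
move=> kn; rewrite leqNgt -idxP //; apply: contraR; rewrite negb_or => /andP[nz nM].
apply/setD1P; split; first by apply: contraNneq nM => ->; rewrite /same.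
apply/topsP; split=> // b /(crit_single kn nz nM)->; exact: leqnn.
Qed.

(** The steps that finish a group; they become the right-to-left maxima of the reconstructed word
    ([cword_rl]). *)
Definition Bd (k : 'I_n) := same (x k.+1) (M k) ord0.

Lemma Bd_last : Bd ord_max.
Proof. by rewrite /Bd atn same_top. Qed.

Lemma zero_Bd (q a : 'I_n) : Bd q -> idx a <= q -> same (x q.+1) (lift ord0 a) ord0.
Proof.
move=> Bq /(idx_le (ltn_ord q))/orP[] /(crit_same (leqnSn q) (ltn_ord q)) // h.
exact: same_trans h Bq.
Qed.

(** By [crit_outside], a letter can become zero only with the block of the greatest letter, hence at
    a step that finishes a group. *)
Lemma zero_idx (a : 'I_n) k : k <= n -> same (x k) (lift ord0 a) ord0 ->
  exists q : 'I_n, [/\ Bd q, q < k & idx a <= q].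
Proof.
elim: k => [|k IH] kn z.
  have : lift ord0 a \in tops (x 0) by rewrite at0 tops_bot_all !inE.
  by move/tops_nz; rewrite z.
have [z'|nz] := boolP (same (x k) (lift ord0 a) ord0).
  by have [q [h1 h2 h3]] := IH (ltnW kn) z'; exists q; split=> //; exact: ltnW.
have aM : same (x k) (lift ord0 a) (M k).
  apply: contraR nz => nM; apply: crit_outside => //.
  by rewrite same_sym M_nz.
exists (Ordinal kn); split=> //=.
  apply: same_trans z; rewrite same_sym; exact: crit_same aM.
rewrite leqNgt -idxP //; apply/negP=> /setD1P[ne aT].
by have /eqP := tops_uniq aT (M_tops kn) aM; rewrite (negbTE ne).
Qed.

Local Notation sg := (grev Bd_last).
Local Notation ge := (gend Bd).
Local Notation gs := (gstart Bd).

(** Letters in order of absorption, each group reversed so that its greatest letter, which comes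
    first in that order, stands at its end. *)
Definition cperm : 'S_n := (sg * (perm idx_inj)^-1)%g.

Lemma idx_cperm p : idx (cperm p) = sg p.
Proof. by rewrite permM -[LHS](permE idx_inj) permKV. Qed.

Lemma cperm_idx p a : idx a = sg p -> a = cperm p.
Proof. by rewrite -idx_cperm => /idx_inj. Qed.

Lemma cperm_nz (p : 'I_n) k : k <= ge p -> ~~ same (x k) (lift ord0 (cperm p)) ord0.
Proof.
move=> kq; apply/negP=> /zero_idx[|q [Bq qk]].
  exact: leq_trans kq (ltnW (ltn_ord _)).
rewrite idx_cperm => sq; have /andP[h _] := grev_bounds Bd_last p.
have := group_inner Bd_last (leq_trans h sq) (leq_trans qk kq).
by rewrite Bq.
Qed.

Lemma M_group (p : 'I_n) k : gs p <= k -> k <= ge p -> M k = M (ge p).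
Proof.
move=> h1 h2; have [d] := ubnP (ge p - k); elim: d k h1 h2 => // d IH k h1 h2.
move: h2; rewrite leq_eqVlt => /orP[/eqP-> //|lt] dk.
have kn : k < n := ltn_trans lt (ltn_ord _).
rewrite -(IH k.+1) //; last by move: dk lt; clear; lia.
  rewrite M_next //; have := group_inner Bd_last (k := Ordinal kn) h1 lt.
  by [].
exact: leqW.
Qed.

Lemma cperm_M (p : 'I_n) k : sg p <= k -> k <= ge p ->
  same (x k) (lift ord0 (cperm p)) (M (ge p)).
Proof.
move=> h1 h2; have kn : k < n := leq_ltn_trans h2 (ltn_ord _).
have /andP[h _] := grev_bounds Bd_last p.
have := @idx_le (cperm p) k kn; rewrite idx_cperm h1 (negbTE (cperm_nz h2)) => /(_ isT) /=.
by rewrite (@M_group p) // (leq_trans h).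
Qed.

(** Signs are read relative to the greatest letter of the group at rank [ge p], the last one at
    which the group is still nonzero. *)
Definition cword : sperm n :=
  (cperm, [ffun p => ~~ srel (x (ge p)) (letter (cperm p) false) (M (ge p), false)]).

Lemma cword_end (p : 'I_n) : srel (x (ge p)) (wd cword p.+1) (M (ge p), false).
Proof.
rewrite wdS ffunE /=; case: (boolP (srel _ (letter _ false) _)) => //= ns.
have /andP[_ h] := grev_bounds Bd_last p.
have := @same_srel _ _ (letter (cperm p) false) (M (ge p), false) (cperm_M h (leqnn _)).
by rewrite (negbTE ns) => -[].
Qed.

(** The opposite relation at rank k would persist up to rank [ge p] and, with the relation defining
    the sign, make the letter zero too early. *)
Lemma cword_M (p : 'I_n) k : sg p <= k -> k <= ge p ->
  srel (x k) (wd cword p.+1) (M (ge p), false).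
Proof.
move=> h1 h2; have := cperm_M h1 h2; have E : (wd cword p.+1).1 = lift ord0 (cperm p) by rewrite wdS.
rewrite -E => /(@same_srel _ _ (wd cword p.+1) (M (ge p), false))[] // h.
have gn : ge p <= n := ltnW (ltn_ord _).
have := srel_bar_same0 (crit_PiB gn) (cword_end p) (crit_srel h2 gn h).
by rewrite E (negbTE (cperm_nz (leqnn _))).
Qed.

Lemma cword_link (p : 'I_n) : link (x (sg p).+1) cword p.
Proof.
have [pq Bq _] := gendP Bd_last p; have [lp _ _] := gstartP Bd_last p.
have Es := grevE Bd_last p.
have [lt|le] := ltnP (gs p) p.
  have p0 : p.-1.+1 = p by rewrite prednK //; exact: leq_trans lt.
  have p1n : p.-1 < n by have := ltn_ord p; lia.
  pose p1 := Ordinal p1n.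
  have Ep : p = p1.+1 :> nat by rewrite /= p0.
  have [E1 E2] : gs p1 = gs p /\ ge p1 = ge p.
    by apply: (group_eq Bd_last); rewrite /=; move: lt pq; clear; lia.
  have Es1 : sg p1 = (sg p).+1 :> nat by rewrite Es grevE E1 E2; move: lt pq Ep; clear; lia.
  have le1 : (sg p).+1 <= ge p by rewrite Es; move: lt pq; clear; lia.
  have Wp : wd cword p = wd cword p1.+1 by rewrite -Ep.
  rewrite /link Wp.
  apply: srel_trans (_ : srel _ _ (M (ge p), false)) _.
    by rewrite -E2; apply: (@cword_M p1); rewrite ?Es1 ?E2.
  by rewrite srel_sym; apply: (@cword_M p) => //; exact: leqnSn.
(* At the first position of a group, the adjacency holds because the group and all earlier ones are
   now zero. *)
have El : gs p = p :> nat by apply/eqP; rewrite eqn_leq lp le.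
have Eq : sg p = ge p :> nat by rewrite Es El; move: pq; clear; lia.
rewrite Eq /link; apply: srel_zero2; first exact/crit_PiB/ltn_ord.
  case Ep: (val p) => [|k]; first by rewrite /same.
  have kn : k < n by have := ltn_ord p; rewrite [nat_of_ord _]Ep; lia.
  rewrite -[k.+1]/(Ordinal kn).+1 wdS /=; apply: zero_Bd => //; rewrite idx_cperm.
  have /andP[_ h] := grev_bounds Bd_last (Ordinal kn).
  apply: leq_trans h _; apply: (gend_le Bd_last Bq) => /=; apply: leq_trans pq.
  by rewrite [nat_of_ord _]Ep.
by rewrite wdS /=; apply: zero_Bd; rewrite // idx_cperm Eq.
Qed.

Lemma M_cperm (q : 'I_n) : Bd q -> M q = lift ord0 (cperm q).
Proof.
move=> Bq; have Eg : ge q = q by exact: (gend_id Bd_last Bq).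
have qn := ltn_ord q; have lq : gs q <= q by have [] := gstartP Bd_last q.
have nz := M_nz qn.
case: (unliftP ord0 (M q)) => [a Ea|E0]; last by rewrite E0 /same eqxx in nz.
rewrite Ea; congr lift; apply: cperm_idx; apply: val_inj; rewrite /= grevE Eg addnK.
apply/eqP; rewrite eqn_leq; apply/andP; split.
  rewrite leqNgt -idxP //; apply/negP=> /setD1P[/eqP[]].
  by have := @M_group q (gs q) (leqnn _); rewrite Eg Ea => ->.
rewrite leqNgt; apply/negP=> lt; have [_ _ /(_ _ lt)[q' /andP[h1 h2] Bq']] := gstartP Bd_last q.
have := zero_Bd Bq' h1; rewrite -Ea => z.
by rewrite (crit_same (leq_trans h2 lq) (ltnW qn) z) in nz.
Qed.

Lemma M_max k a : k < n -> ~~ same (x k) a ord0 -> a <= M k.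
Proof. by move=> kn; have [_] := MxP (crit_tops0 kn); apply. Qed.

Lemma cword_rl : rl_max cword =1 Bd.
Proof.
move=> p; apply/idP/idP => [|Bp].
  apply: contraTT => nB; have [pq Bq _] := gendP Bd_last p.
  have ltq : p < ge p.
    by rewrite ltn_neqAle pq andbT; apply: contraNneq nB => /val_inj E; rewrite {1}E.
  rewrite negb_forall; apply/existsP; exists (ge p); rewrite negb_imply ltq /= -leqNgt.
  have := M_max (ltn_ord (ge p)) (cperm_nz (leqnn (ge p))).
  by rewrite (M_cperm Bq).
apply/forallP=> j; apply/implyP=> pj.
have /andP[h _] := grev_bounds Bd_last j.
have : lift ord0 (cperm j) \in trem p.
  by rewrite idxP // idx_cperm; apply: leq_trans h; exact: (gstart_lt Bd_last Bp pj).
case/setD1P=> ne /tops_nz/(M_max (ltn_ord p)).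
by rewrite leq_eqVlt => /orP[/eqP/val_inj E|]; [rewrite E eqxx in ne|rewrite (M_cperm Bp)].
Qed.

(** At each rank, the splitting of [cword] lies below the element of [C] because its uncut
    adjacencies hold there; the coranks agree, so the two are equal. *)
Lemma critical_fchain : exists2 u, rl_max_unbarred u & C = fchain u.
Proof.
exists cword.
  apply/forallP=> p; apply/implyP; rewrite cword_rl => Bp.
  by rewrite ffunE negbK (gend_id Bd_last Bp) (M_cperm Bp) srel_refl.
apply: at_ext => //; first exact: fchain_mchain.
move=> k /andP[_ kn]; rewrite at_fchain ?(ltnW kn) //; apply/esym.
apply: sple_tops_eq; rewrite ?split_PiB ?crit_PiB ?(ltnW kn) //.
  apply/split_leP; first exact/crit_PiB/ltnW.
  move=> p; rewrite inE -ltnNge (grev_ext _ Bd_last cword_rl) => lt.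
  by apply: (crit_srel lt (ltnW kn)); exact: cword_link.
by rewrite card_tops_split card_sset ?(ltnW kn) // at_tops // ltnW.
Qed.

End Critical.

(** * The sublattices of a signed permutation *)

Lemma zero_block_cuts m (v : sperm m.+1) S a (p : 'I_m.+1) :
  [set zero_letter m.+1; letter a false] \in split_at v S -> (cuts S p.+1 == 0) = (v.1 p == a).
Proof.
move=> bS; have H := zero_block_srel (split_PiB v S) bS.
have := H (lift ord0 (v.1 p)); rewrite srel0 ?split_PiB // same_split_zero => ->.
by rewrite /= (inj_eq (@lift_inj _ ord0)).
Qed.

Lemma zero_letter_pos m (v : sperm m.+1) S a :
  [set zero_letter m.+1; letter a false] \in split_at v S -> a = v.1 ord0.
Proof.
move=> bS; have Z p := zero_block_cuts p bS.
have [p Ep] : exists p, v.1 p = a by exists ((v.1^-1)%g a); rewrite permKV.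
apply/esym/eqP; rewrite -Z; have := Z p; rewrite Ep eqxx => /cuts0 h.
by apply/cuts0 => s /h; exact: leq_ltn_trans.
Qed.

(** * The Boolean lattice of type D *)

Section Flip.
Variable m : nat.
Local Notation n := m.+1.
Implicit Types (u v : sperm n) (S : {set 'I_n}) (p : 'I_n) (T : {set 'I_n}).
Hypothesis m0 : 0 < m.

Definition pos1 : 'I_n := inord 1.

Lemma val_pos1 : pos1 = 1 :> nat. Proof. by rewrite inordK. Qed.

Lemma pos1_neq0 : (pos1 == ord0) = false.
Proof. by rewrite -val_eqE /= val_pos1. Qed.

Lemma wd_flip u k : k != 1 -> wd (flip_first u) k = wd u k.
Proof.
case: k => [|k] // k1; rewrite /wd; case: insubP => [i _ Ei|] //=.
by rewrite ffunE -[X in X == 0]/(val i) Ei; case: k k1 {Ei} => //= k _; rewrite addbF.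
Qed.

Lemma wd_flip1 u : wd (flip_first u) 1 = sbar (wd u 1).
Proof. by rewrite (wdS (flip_first u) ord0) (wdS u ord0) ffunE addbT. Qed.

Lemma cuts1 S : (cuts S 1 == 0) = (ord0 \notin S).
Proof.
apply/cuts0/idP => [H|H s sS]; first by apply/negP=> /H.
by rewrite lt0n; apply: contraNneq H => /(@ord_inj _ s ord0) <-.
Qed.

Lemma cuts2 S : (cuts S 2 == 0) = (ord0 \notin S) && (pos1 \notin S).
Proof.
apply/cuts0/andP => [H|[H0 H1] s sS].
  by split; apply/negP=> /H; rewrite ?val_pos1.
rewrite ltn_neqAle lt0n; apply/andP; split.
  by apply: contraNneq H1; rewrite -val_pos1 => /ord_inj->.
by apply: contraNneq H0 => /(@ord_inj _ s ord0) <-.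
Qed.

Lemma link_flip t u p : p != ord0 -> p != pos1 -> link t (flip_first u) p = link t u p.
Proof.
rewrite -!val_eqE /= val_pos1 => p0 p1; rewrite /link !wd_flip //.
Qed.

(** The first letter is then either in the zero block, where signs vanish, or alone in a nonzero
    block, where normalization removes its sign. *)
Lemma split_flip u S : (ord0 \notin S) || (ord0 \in S) && (pos1 \in S) ->
  split_at (flip_first u) S = split_at u S.
Proof.
move=> H; apply: sple_tops_eq; rewrite ?split_PiB ?card_tops_split //.
apply/split_leP; first exact: split_PiB.
move=> p pS; have [p0|p0] := eqVneq p ord0.
  move: H; rewrite -p0 (negbTE pS) /= => _; rewrite p0 in pS *.
  have L : srel (split_at u S) (zero_letter n) (wd u 1) by have := link_split u S ord0; rewrite pS.
  rewrite /link wd_flip // wd_flip1 -[wd u _]/(zero_letter n) srel_sym.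
  by rewrite srel_zero_bar ?split_PiB // srel_sym.
have [p1|p1] := eqVneq p pos1; last by rewrite link_flip // link_split.
move: H; rewrite -p1 (negbTE pS) andbF orbF => S0.
rewrite /link p1 val_pos1 wd_flip1 wd_flip // split_srel_bar // cuts1 cuts2 S0.
by rewrite -p1 pS.
Qed.

(* The Boolean lattice of type D: a cut set S lists the adjacencies that are not
   imposed, where p = 0 stands for that of the barred first letter with the
   second one, and p = 1 for that of the first letter with the second one. *)
Definition dspecial S := (ord0 \notin S) && (pos1 \in S).
Definition dshift S := ord0 |: S :\ pos1.
(** In the special case [split_at u S] would have a zero block of size two. Instead only the barred
    first letter is joined to the second one, which is a splitting of the flipped word with cut 1
    replaced by 0. *)
Definition dsplit u S := if dspecial S then split_at (flip_first u) (dshift S) else split_at u S.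

Definition dlink t u p := if p == ord0 then link t (flip_first u) pos1 else link t u p.

Lemma in_dshift S p : (p \in dshift S) = (p == ord0) || (p != pos1) && (p \in S).
Proof. by rewrite !inE. Qed.

Lemma dlink_dsplit u S p : dlink (dsplit u S) u p = (p \notin S).
Proof.
rewrite /dsplit; case: (boolP (dspecial S)) => [/andP[S0 S1]|sp]; rewrite /dlink.
  have [->|p0] := eqVneq p ord0.
    by rewrite link_split in_dshift pos1_neq0 eqxx S0.
  have [->|p1] := eqVneq p pos1.
    rewrite S1 /= /link val_pos1 -(wd_flip u (k := 2)) //.
    have -> : wd u 1 = sbar (wd (flip_first u) 1) by rewrite wd_flip1 sbarK.
    by rewrite split_srel_bar // cuts1 in_dshift eqxx.
  by rewrite -link_flip // link_split in_dshift (negbTE p0) (negbTE p1).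
have [->|p0] := eqVneq p ord0; last by rewrite link_split.
rewrite /link val_pos1 wd_flip1 wd_flip // split_srel_bar // cuts1 cuts2 andbA andbb.
by move: sp; rewrite /dspecial; do 2!case: (_ \in _).
Qed.

Lemma card_dshift S : dspecial S -> #|dshift S| = #|S|.
Proof.
case/andP=> S0 S1; rewrite cardsU1 !inE eq_sym pos1_neq0 /= (cardsD1 pos1 S) S1.
by rewrite S0.
Qed.

Lemma dsplit_PiB u S : dsplit u S \in PiB n.
Proof. by rewrite /dsplit; case: ifP => _; exact: split_PiB. Qed.

Lemma card_tops_dsplit u S : #|tops (dsplit u S)| = #|S|.
Proof. by rewrite /dsplit; case: ifP => [/card_dshift <-|_]; rewrite card_tops_split. Qed.

(** Inclusion is read off from the monotone conditions [dlink]; conversely, when only one side is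
    special, [split_flip] rewrites the other as a splitting of the flipped word. *)
Lemma dsplit_le u S S' : sple (dsplit u S) (dsplit u S') = (S' \subset S).
Proof.
apply/idP/idP => [le|/subsetP sub].
  apply/subsetP=> p pS'; have := dlink_dsplit u S p; case: (p \in S) => //.
  have : ~~ dlink (dsplit u S') u p by rewrite dlink_dsplit negbK.
  rewrite /dlink /link => h; case: ifP h => _ /negP h /(sple_srel (dsplit_PiB u S) (dsplit_PiB u S') le) //.
rewrite /dsplit; case: ifP => [/andP[S0 S1]|/negbT sp]; case: ifP => [/andP[S0' S1']|/negbT sp'].
- rewrite split_le; apply/subsetP=> p; rewrite !in_dshift => /orP[->//|/andP[-> /sub->]].
  by rewrite orbT.
- have n0 : ord0 \notin S' by apply: contra S0; exact: sub.
  have n1 : pos1 \notin S' by move: sp'; rewrite /dspecial n0.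
  rewrite -(split_flip u (S := S')) ?n0 // split_le; apply/subsetP=> p pS'.
  rewrite in_dshift sub // andbT; apply/orP; right; by apply: contraNneq n1 => <-.
- have s1 : pos1 \in S by exact: sub.
  have s0 : ord0 \in S by move: sp; rewrite /dspecial s1 andbT negbK.
  rewrite -(split_flip u (S := S)) ?s0 ?s1 // split_le; apply/subsetP=> p.
  by rewrite in_dshift => /orP[/eqP->//|/andP[_ /sub]].
- by rewrite split_le; apply/subsetP.
Qed.

(** A zero block of size two consists of 0 and the first letter, which makes 1 the smallest cut. *)
Lemma split_PiD v S : min_not_one S -> split_at v S \in PiD n.
Proof.
move=> mS; rewrite inE split_PiB; apply/forall_inP=> b bS; apply/implyP=> zb.
apply/eqP=> /eqP/cards2P[x0 [y0 [ne Eb]]].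
have [a Eb'] : exists a, b = [set zero_letter n; letter a false].
  have [y yz Ey] : exists2 y, y != zero_letter n & b = [set zero_letter n; y].
    move: zb; rewrite Eb !inE => /orP[]/eqP->; first by exists y0; rewrite // eq_sym.
    by exists x0 => //; rewrite setUC.
  have yb : y \in b by rewrite Ey !inE eqxx orbT.
  have [E1 E2] := lblock_eq (split_PiB v S) bS yb.
  have y2 : y.2 = false.
    by rewrite E2; apply: zero_sign; [exact: split_PiB|rewrite E1].
  case: y yz Ey y2 {yb E1 E2} => c s /= yz Ey Es; rewrite Es in yz Ey.
  case: (unliftP ord0 c) yz Ey => [a -> _ ->|-> //]; by exists a.
rewrite Eb' in bS; have Z p := zero_block_cuts p bS; have E0 := esym (zero_letter_pos bS).
have Z0 : cuts S 1 == 0 by have := Z ord0; rewrite E0 eqxx.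
have := Z pos1; rewrite -E0 (inj_eq perm_inj) pos1_neq0 val_pos1 cuts2 -cuts1 Z0 /= => /negbFE s1.
have /forall_inP/(_ _ s1)/implyP := mS; rewrite val_pos1 => h.
suff : false by []; apply: h; apply/forall_inP=> j jS.
by move/cuts0: Z0 => /(_ j jS).
Qed.

Lemma dsplit_tPi u S : dsplit u S \in tPi_sp u.
Proof.
have [S' [mS' ES]] : exists S', min_not_one S' /\ (dsplit u S == split_at u S') || (dsplit u S == split_at (flip_first u) S').
  rewrite /dsplit; case: ifP => [_|/negbT sp].
    exists (dshift S); rewrite eqxx orbT; split=> //.
    apply/forall_inP=> i _; apply/implyP=> /forall_inP/(_ ord0); rewrite in_dshift eqxx => /(_ isT).
    by rewrite leqn0 => /eqP->.
  exists S; rewrite eqxx; split=> //; apply/forall_inP=> i iS; apply/implyP=> /forall_inP h.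
  apply: contra sp => /eqP i1; have Ei : i = pos1 by apply: ord_inj; rewrite val_pos1.
  rewrite /dspecial -Ei iS andbT; apply/negP=> /h; by rewrite i1.
rewrite inE; apply/andP; split; last by apply/existsP; exists S'; rewrite mS' ES.
by case/orP: ES => /eqP->; exact: split_PiD.
Qed.

Lemma tPi_PiB u : tPi_sp u \subset PiB n.
Proof. by apply/subsetP=> x; rewrite inE => /andP[]; rewrite inE => /andP[]. Qed.

Lemma bot_tPi u : bot n \in tPi_sp u.
Proof.
by have := dsplit_tPi u setT; rewrite /dsplit /dspecial !inE split_setT.
Qed.

Lemma top_tPi u : top n \in tPi_sp u.
Proof.
by have := dsplit_tPi u set0; rewrite /dsplit /dspecial !inE split_set0.
Qed.

Lemma tPi_sub u T : tPi_sp u \subset PiDB T.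
Proof.
apply/subsetP=> x; rewrite inE => /andP[+ _]; rewrite inE => /andP[xP /forall_inP H].
rewrite inE xP; apply/forallP=> a; apply/implyP=> _; apply/negP=> /H.
by rewrite !inE eqxx cards2.
Qed.

End Flip.

Section PiSp.
Variable m : nat.
Local Notation n := m.+1.
Implicit Types (u v : sperm n) (S : {set 'I_n}) (p : 'I_n) (T : {set 'I_n}).

Lemma split_Pi u S : split_at u S \in Pi_sp u.
Proof. by rewrite inE split_PiB; apply/existsP; exists S. Qed.

Lemma Pi_PiB u : Pi_sp u \subset PiB n.
Proof. by apply/subsetP=> x; rewrite inE => /andP[]. Qed.

Lemma bot_Pi u : bot n \in Pi_sp u. Proof. by rewrite -(split_setT u) split_Pi. Qed.
Lemma top_Pi u : top n \in Pi_sp u. Proof. by rewrite -(split_set0 u) split_Pi. Qed.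

Lemma Pi_sub u T : u.1 ord0 \in T -> Pi_sp u \subset PiDB T.
Proof.
move=> uT; apply/subsetP=> x; rewrite inE => /andP[xP /existsP[S /eqP Ex]].
rewrite inE xP; apply/forallP=> a; apply/implyP; apply: contra.
by rewrite Ex => /zero_letter_pos->.
Qed.

Lemma PiDB_PiB T : PiDB T \subset PiB n.
Proof. by apply/subsetP=> x; rewrite inE => /andP[]. Qed.

Lemma bot_PiDB T : bot n \in PiDB T.
Proof.
rewrite inE bot_PiB; apply/forallP=> a; apply/implyP=> _; apply/negP=> /(zero_block_srel (bot_PiB n)).
move/(_ (lift ord0 a)); rewrite eqxx orbT srel0 ?bot_PiB //=.
by apply/negP/tops_nz; rewrite tops_bot_all !inE.
Qed.

(** The one-block partition has a zero block {0, a} only for n = 1, and it is then excluded only if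
    T is empty. *)
Lemma top_PiDB T : (m = 0 -> T != set0) -> top n \in PiDB T.
Proof.
move=> nd; rewrite inE top_PiB; apply/forallP=> a; apply/implyP=> aT; apply/negP.
move=> /(zero_block_srel (top_PiB n)) H.
have all_a b : b = a.
  have := H (lift ord0 b); rewrite srel0 ?top_PiB // same_top /= => /esym/eqP/lift_inj //.
have mz : m = 0 by have := congr1 val (etrans (all_a ord_max) (esym (all_a ord0))).
by have /set0Pn[b bT] := nd mz; rewrite -(all_a b) bT in aT.
Qed.

End PiSp.

(** * Cycles vanishing on the selected facets *)

Section FirstGroup.
Variable m : nat.
Local Notation n := m.+1.
Implicit Types (u v : sperm n) (S : {set 'I_n}) (p q : 'I_n) (T : {set 'I_n}).

Definition fend u := cend u ord0.

(** While the first group is processed, later positions are all cut, and position p of the group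
    loses its cut at step [fend u] - p. *)
Lemma mem_sset u k p : k <= (fend u).+1 -> (p \in sset u k) = (fend u < p) || (k + p <= fend u).
Proof.
move=> kq; rewrite inE; have [_ Bq _] := gendP (rl_max_last u) ord0.
have [lt|le] := ltnP (fend u) p => /=.
  have /andP[h _] := grev_bounds (rl_max_last u) p.
  have := gstart_lt (rl_max_last u) Bq lt; rewrite -/(cend u ord0) -/(fend u).
  by rewrite /crev; move: h kq; clear; lia.
have [l0 _ _] := gstartP (rl_max_last u) ord0.
have [E1 E2] : cstart u p = cstart u ord0 /\ cend u p = cend u ord0.
  by apply: (group_eq (rl_max_last u)) => //; exact: leq_trans l0 _.
rewrite /crev grevE -/(cend u p) -/(cstart u p) E1 E2 -/(fend u).
by move: l0; rewrite leqn0 => /eqP l0; rewrite /cstart l0 add0n leq_subRL // addnC.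
Qed.

Lemma rl_max_flip u : rl_max (flip_first u) =1 rl_max u.
Proof. by []. Qed.

Lemma sset_flip u k : sset (flip_first u) k = sset u k.
Proof.
apply/setP=> p; rewrite !inE.
by rewrite (grev_ext (rl_max_last (flip_first u)) (rl_max_last u) (rl_max_flip u)).
Qed.

Lemma fend_max u p : u.1 p <= u.1 (fend u).
Proof. exact: rl_max_end. Qed.

Lemma fend0 u : u.1 ord0 = ord_max -> fend u = ord0.
Proof.
move=> E; apply: (gend_id (rl_max_last u)); apply/forallP=> j; apply/implyP=> j0.
rewrite E ltn_neqAle -ltnS ltn_ord andbT; apply: contraTneq j0.
by rewrite -E => /ord_inj/perm_inj->.
Qed.

Lemma in_D_flip u : in_D (flip_first u) = ~~ in_D u.
Proof.
rewrite /in_D negbK (cardsD1 ord0) [in RHS](cardsD1 ord0) !inE ffunE /= addbT.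
rewrite (_ : [set i | (flip_first u).2 i] :\ ord0 = [set i | u.2 i] :\ ord0).
  by rewrite !oddD !oddb -addNb negbK.
by apply/setP=> i; rewrite !inE ffunE -val_eqE; case: eqP => //=; rewrite addbF.
Qed.

Lemma basisBP T u : basisB T u = (u.1 ord0 \in T) && rl_max_unbarred u.
Proof.
rewrite /basisB; congr andb; apply/existsP/idP => [[i /andP[/eqP i0]]|h]; last by exists ord0.
by have -> : i = ord0 by apply: ord_inj.
Qed.

Lemma basisDP T u : basisD T u =
  [&& in_D u, u.1 ord0 \notin T, u.1 ord0 != ord_max & rl_max_unbarred u].
Proof.
rewrite /basisD; congr andb; rewrite andbA; congr andb.
have E i : ((u.1 i).+1 != n) = (u.1 i != ord_max) by rewrite eqSS -val_eqE.
apply/existsP/andP => [[i /and3P[/eqP i0]]|[h1 h2]]; last by exists ord0; rewrite h1 E h2.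
by have -> : i = ord0 by apply: ord_inj; rewrite i0.
Qed.

End FirstGroup.

Section Spanning.
Variables (m : nat) (T : {set 'I_m.+1}).
Local Notation n := m.+1.
Hypothesis nd : m = 0 -> T != set0.
Local Notation L := (PiDB T).
Variable c : ochain (blocks n).
Hypothesis cP : is_cycle (@sple n) (proper_part (@sple n) L) (n%:Z - 2)%R c.
Hypothesis cB : forall u, basisB T u -> c (fchain u) = 0%R.
Hypothesis cD : forall u, basisD T u -> c (fchain u) = 0%R.

Lemma supp_chain C : c C != 0%R -> mchain C /\ C \subset L.
Proof.
move=> h; have [cd _] := cP; have := cd C h.
by rewrite simplex_mchain ?PiDB_PiB ?bot_PiDB ?top_PiDB // => /andP.
Qed.

Lemma no_zero_pair x a : x \in L -> a \notin T ->
  ~ (forall b : 'I_n, same x (lift ord0 b) ord0 = (b == a)).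
Proof.
rewrite inE => /andP[xP /forallP/(_ a)/implyP H] aT E; have /negP := H aT; apply.
apply: zero_blockP => // b; rewrite srel0 //=.
case: (unliftP ord0 b) => [b' ->|->]; last by rewrite /same eqxx.
by rewrite E /= (inj_eq (@lift_inj _ ord0)).
Qed.

(** * The exchange in the first group when its first letter is outside T *)

Section Exceptional.
Variable u : sperm n.
Hypothesis FL : fchain u \subset L.
Hypothesis ru : rl_max_unbarred u.
Hypothesis u0T : u.1 ord0 \notin T.

Let q := fend u.
Local Notation x k := (chain_at (fchain u) k).
Local Notation N := (lift ord0 (u.1 q)).

Lemma fx_PiB k : k <= n -> x k \in PiB n.
Proof. by apply: at_PiB; exact: fchain_mchain. Qed.

(** A one-letter first group would give the element of rank 1 the excluded zero block {0, u(1)}; for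
    n = 1 no first letter lies outside T. *)
Lemma fend_gt0 : 0 < q.
Proof.
rewrite lt0n; apply/negP=> q0.
have q0' : fend u = ord0 by apply: ord_inj; exact/eqP.
have [E|mpos] := posnP m.
  have /set0Pn[b bT] := nd E; move: u0T; suff -> : u.1 ord0 = b by rewrite bT.
  by apply: ord_inj; have := ltn_ord b; have := ltn_ord (u.1 ord0); move: E; clear; lia.
have h1 : 0 < 1 < n by rewrite ltnS.
have [xC _] := at_in (fchain_mchain u) h1.
apply: (no_zero_pair (subsetP FL _ xC) u0T) => b; rewrite at_fchain //.
have [p ->] : exists p, b = u.1 p by exists ((u.1^-1)%g b); rewrite permKV.
rewrite same_split_zero (inj_eq perm_inj); apply/cuts0/eqP => [H|-> s].
  have := H p; rewrite mem_sset ?q0' //= ltnn add1n ltn0 orbF => h.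
  by apply: ord_inj => /=; move: h; case: (val p) => // k /(_ isT).
by rewrite mem_sset ?q0' //= add1n ltn0 orbF.
Qed.

Lemma q_lt : q < n. Proof. exact: ltn_ord. Qed.

Lemma fx_nz k (p : 'I_n) : k <= q -> ~~ same (x k) (lift ord0 (u.1 p)) ord0.
Proof.
move=> kq; have kn : k <= n := leq_trans kq (ltnW q_lt).
rewrite at_fchain // same_split_zero; apply/cuts0 => /(_ ord0).
by rewrite mem_sset ?leqW //= addn0 kq => /(_ isT).
Qed.

Lemma fx_Mx k : k <= q -> Mx (x k) = N.
Proof.
move=> kq; have kn : k < n := leq_ltn_trans kq q_lt.
have [nz H] := MxP (at_tops0 (fchain_mchain u) kn).
apply: ord_inj; apply/eqP; rewrite eqn_leq H ?fx_nz // andbT.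
case: (unliftP ord0 (Mx (x k))) => [a ->|->]; last by [].
have [p ->] : exists p, a = u.1 p by exists ((u.1^-1)%g a); rewrite permKV.
exact: fend_max.
Qed.

Lemma fx_prev (p : 'I_n) : 0 < p -> p <= q -> srel (x q.-1) (wd u p.+1) (wd u q.+1).
Proof.
move=> p0 pq; have q0 := fend_gt0.
rewrite at_fchain; last by exact: leq_trans (leq_pred q) (ltnW q_lt).
rewrite split_srel //; apply/cuts_eqP => // s; rewrite mem_sset; last by exact: leq_trans (leq_pred q) (leqnSn q).
by rewrite -/q => /orP[//|]; move: q0 p0; clear; lia.
Qed.

(** At rank q - 1 all of the first group but its first letter is joined; only the relative sign of
    that letter remains to be chosen. *)
Lemma exceptional_flip y : y \in PiB n -> sple (x q.-1) y -> #|tops y| = n - q ->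
  same y (lift ord0 (u.1 ord0)) N ->
  y = split_at u (sset u q) \/ y = split_at (flip_first u) (sset u q).
Proof.
move=> yP le ty s0; have q0 := fend_gt0.
have qn1 : q.-1 <= n by exact: leq_trans (leq_pred q) (ltnW q_lt).
have m0 : 0 < m by have := q_lt; move: q0; clear; lia.
have key v : (forall k, k != 1 -> wd v k = wd u k) -> srel y (wd v 1) (wd u q.+1) ->
    y = split_at v (sset u q).
  move=> wv h; apply/esym/sple_tops_eq; rewrite ?split_PiB //; last first.
    by rewrite card_tops_split card_sset ?ty // ltnW // q_lt.
  apply/split_leP => // p; rewrite mem_sset ?leqnSn // -/q negb_or -leqNgt -ltnNge => /andP[pq qp].
  have p0 : 0 < p by move: qp; clear; lia.
  have up : srel y (wd u p.+1) (wd u q.+1) by apply: sple_srel le _; rewrite ?fx_PiB // fx_prev.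
  rewrite /link (wv p.+1); last by rewrite eqSS -lt0n.
  have [p1|p1] := eqVneq (nat_of_ord p) 1.
    by rewrite p1 in up *; apply: srel_trans h _; rewrite srel_sym.
  have pn : p.-1 < n by exact: leq_ltn_trans (leq_pred p) (ltn_ord p).
  have p1' : (Ordinal pn).+1 = p :> nat by rewrite /= prednK.
  have up' : srel y (wd u (Ordinal pn).+1) (wd u q.+1).
    apply: sple_srel le _; rewrite ?fx_PiB //; apply: fx_prev => /=; move: p0 p1 pq; clear; lia.
  rewrite p1' in up'; rewrite (wv p) //; apply: srel_trans up' _.
  by rewrite srel_sym.
have E1 : (wd u 1).1 = lift ord0 (u.1 ord0) by rewrite (wdS u ord0).
have E2 : (wd u q.+1).1 = N by rewrite wdS.
rewrite -E1 -E2 in s0; case: (same_srel s0) => h.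
  by left; apply: key.
by right; apply: key; [move=> k; exact: wd_flip|rewrite wd_flip1].
Qed.

(** The tops of [y] are [N] and those of rank q + 1, so the first letter is with [N] or zero. If
    zero, it would be the only one, as the rest of the group stays with [N]: an excluded zero
    block. *)
Lemma exceptional_zero y : y \in L -> sple (x q.-1) y -> sple y (x q.+1) -> #|tops y| = n - q ->
  ~~ same y N ord0 -> same y (lift ord0 (u.1 ord0)) N.
Proof.
move=> yL le1 le2 ty nN; have q0 := fend_gt0; have qn := q_lt.
have yP : y \in PiB n := subsetP (PiDB_PiB T) _ yL.
have qn1 : q.-1 <= n by exact: leq_trans (leq_pred q) (ltnW qn).
have ap := fx_PiB qn1; have tp := fx_PiB qn.
have tz (p : 'I_n) : same (x q.+1) (lift ord0 (u.1 p)) ord0 = (p <= q).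
  rewrite at_fchain // same_split_zero; apply/cuts0/idP => [H|pq s].
    rewrite leqNgt; apply/negP=> qp.
    have hq : q.+1 < n := leq_ltn_trans qp (ltn_ord p).
    by have := H (Ordinal hq); rewrite mem_sset //= -/q ltnSn => /(_ isT); rewrite ltnNge qp.
  by rewrite mem_sset // -/q => /orP[|]; move: pq; clear; lia.
have Ntop : N \in tops y.
  apply/topsP; split=> // b.
  case: (unliftP ord0 b) => [a ->|->] // _.
  have [p ->] : exists p, a = u.1 p by exists ((u.1^-1)%g a); rewrite permKV.
  exact: fend_max.
have Nt : N \notin tops (x q.+1) by apply/negP=> /tops_nz; rewrite tz leqnn.
have Ey : tops y = N |: tops (x q.+1).
  apply/esym/eqP; rewrite eqEcard subUset sub1set Ntop (tops_anti yP tp le2) /= cardsU1 Nt.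
  by rewrite (at_tops (fchain_mchain u) qn) ty; move: qn; clear; lia.
have [z|nz] := boolP (same y (lift ord0 (u.1 ord0)) ord0); last first.
  have [d dy /andP[dw _]] := top_exists nz.
  move: dy; rewrite Ey in_setU1 => /orP[/eqP <-|dt]; first by rewrite same_sym.
  have /negP[] := tops_nz dt; apply: same_trans (sple_same yP tp le2 dw) _.
  by rewrite tz.
exfalso; apply: (no_zero_pair yL u0T) => b.
have [p ->] : exists p, b = u.1 p by exists ((u.1^-1)%g b); rewrite permKV.
rewrite (inj_eq perm_inj); have [-> //|p0] := eqVneq p ord0.
apply/negP=> zp.
have [pq|qp] := leqP p q; last first.
  by have := sple_same yP tp le2 zp; rewrite tz leqNgt qp.
have pN : same (x q.-1) (lift ord0 (u.1 p)) N.
  have := srel_same (@fx_prev p _ pq); rewrite !wdS; apply.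
  by rewrite lt0n -[0]/(val (@ord0 m)) (inj_eq val_inj).
have /negP := nN; apply; apply: same_trans zp; rewrite same_sym.
exact: sple_same le1 pN.
Qed.

End Exceptional.

Lemma cycle_zero C : c C = 0%R.
Proof.
(* Downward induction on the weight, which is below 3 ^ n. *)
have [k] := ubnP (3 ^ n - weight C); elim: k C => // k IH C; rewrite ltnS => wk.
apply/eqP; apply: contraT => cC; have [mC CL] := supp_chain cC.
have [_ cb] := cP.
have up C' : mchain C' -> weight C < weight C' -> c C' = 0%R.
  move=> mC' lt; apply: IH; apply: leq_trans wk.
  have := @ternary_ub (fun k => step_value (chain_at C' k) (chain_at C' k.+1)) n (fun j => step_value_le2 _ _).
  by rewrite -/(weight C'); move: lt; clear; lia.
suff E0 : c C = 0%R by rewrite E0 eqxx in cC.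
have [/existsP[j /eqP nc]|crit] := boolP [exists j : 'I_n, step_value (chain_at C j) (chain_at C j.+1) == 0].
  have [|i hi H] := noncritical mC; first by exists (nat_of_ord j); [exact: ltn_ord|exact: nc].
  have [iC _] := at_in mC hi; apply: cycle_isolated cb iC _ => C' y yC' E ne.
  apply/eqP; apply: contraT => cC'; have [mC' _] := supp_chain cC'.
  by rewrite up ?eqxx // in cC'; exact: H E ne.
have [u ru EC] : exists2 u, rl_max_unbarred u & C = fchain u.
  apply: critical_fchain => // j jn; have := existsPn crit (Ordinal jn); rewrite /= /step_value.
  case: ifP => [z _|_]; last by case: changed.
  by apply: changed_zero; rewrite ?at_PiB ?at_tops0 // ltnW.
rewrite EC in CL mC up cC *.
have [u0T|u0T] := boolP (u.1 ord0 \in T); first by apply: cB; rewrite basisBP u0T.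
have q0 := fend_gt0 CL u0T; have qn := ltn_ord (fend u); set q := fend u in q0 qn.
have m0 : 0 < m by move: q0 qn; clear; lia.
have nmax : u.1 ord0 != ord_max by apply/eqP=> /fend0 E; rewrite /q E in q0.
have [uD|uD] := boolP (in_D u); first by apply: cD; rewrite basisDP uD u0T nmax.
have rf : rl_max_unbarred (flip_first u).
  apply/forallP=> p; apply/implyP=> rp; rewrite ffunE.
  have pn0 : (p == 0 :> nat) = false.
    apply/eqP=> p0; have Ep : p = ord0 by apply: ord_inj.
    rewrite Ep in rp; have := gend_id (rl_max_last u) (q := ord0) rp.
    by rewrite -/(cend u ord0) -/(fend u) => E; rewrite /q E in q0.
  by rewrite pn0 addbF; exact: (implyP (forallP ru p) rp).
have bf : basisD T (flip_first u) by rewrite basisDP in_D_flip uD u0T nmax.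
have hq : 0 < q < n by rewrite q0.
have [qC _] := at_in mC hq; apply: cycle_isolated cb qC _ => C' y yC' E ne.
apply/eqP; apply: contraT => cC'; have [mC' CL'] := supp_chain cC'.
have [A Ey ny] := mchain_replace mC mC' hq yC' E ne.
have yL : y \in L := subsetP CL' _ yC'.
have yP : y \in PiB n := subsetP (PiDB_PiB T) _ yL.
have qn1 : q.-1 <= n by exact: leq_trans (leq_pred q) (ltnW qn).
have Ap : chain_at C' q.-1 = chain_at (fchain u) q.-1 by apply: A => //; move: q0; clear; lia.
have An : chain_at C' q.+1 = chain_at (fchain u) q.+1 by apply: A => //; rewrite gtn_eqF.
have le1 : sple (chain_at (fchain u) q.-1) y.
  by rewrite -Ey -Ap; apply: at_le; rewrite ?leq_pred ?(ltnW qn).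
have le2 : sple y (chain_at (fchain u) q.+1) by rewrite -Ey -An; apply: at_le.
have ty : #|tops y| = n - q by rewrite -Ey at_tops // ltnW.
have M1 : Mx (chain_at (fchain u) q.-1) = lift ord0 (u.1 q) by apply: fx_Mx => //; exact: leq_pred.
have [z|nz] := boolP (same y (lift ord0 (u.1 q)) ord0).
  rewrite up ?eqxx // in cC'; apply: (weight_replace mC mC' hq yC' E ne).
  rewrite /step_value M1 z (negbTE (fx_nz _ (leqnn _))); by case: changed.
have s0 := exceptional_zero CL u0T yL le1 le2 ty nz.
case: (exceptional_flip CL u0T yP le1 ty s0) => Efl.
  by move: ny; rewrite at_fchain ?(ltnW qn) // Efl eqxx.
(* Away from rank q the cut sets contain both 0 and 1 or miss 0, so [split_flip] makes the two
   facets agree there. *)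
suff EC' : C' = fchain (flip_first u) by rewrite EC' cD ?eqxx in cC'.
apply: at_ext => //; first exact: fchain_mchain.
move=> j /andP[j0 jn]; rewrite at_fchain ?(ltnW jn) // sset_flip.
have [->|jq] := eqVneq j (q : nat); first by rewrite Ey.
rewrite A ?(ltnW jn) // at_fchain ?(ltnW jn) // split_flip //.
have [jq'|qj] := leqP j q.
  rewrite !mem_sset ?(leqW jq') //= addn0 -/q jq' /= val_pos1 //.
  by move: jq jq'; clear; lia.
apply/orP; left; rewrite inE -ltnNge /crev grevE subn0.
have [l0 _ _] := gstartP (rl_max_last u) ord0.
by move: qj l0; rewrite -/(cend u ord0) -/(fend u) -/q /=; clear; lia.
Qed.

End Spanning.

Local Open Scope ring_scope.

(** * The basis *)

Section Coefficients.
Variable m : nat.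
Local Notation n := m.+1.
Implicit Types (u : sperm n) (rho : ochain (blocks n)).

Lemma dimS : m%:Z = n%:Z - 2 + 1.
Proof. by apply/eqP; rewrite dim_eq. Qed.

Lemma fundamental_bchain (Q : {set blocks n}) (g : {set 'I_n} -> blocks n) rho s :
  Q \subset PiB n -> bot n \in Q -> top n \in Q ->
  (forall S S', sple (g S) (g S') = (S' \subset S)) ->
  (forall S, g S \in Q) -> (forall S, #|tops (g S)| = #|S|) ->
  fundamental_cycle (@sple n) (proper_part (@sple n) Q) (n%:Z - 2) rho ->
  rho (bchain g s) * rho (bchain g s) = 1.
Proof.
move=> QB bQ tQ gle gQ gtops fund.
have gP S : S != set0 -> S != setT -> g S \in proper_part (@sple n) Q.
  move=> S0 ST; rewrite proper_partE // gQ gtops card_gt0 S0 /=.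
  by rewrite -[X in (_ < X)%N]card_ord -cardsT proper_card // properT.
apply: fundamental_coef fund (bcycle_cycle gle gP dimS) _.
  by move=> C; apply: no_simplex.
by rewrite (bcycleE gle) -exprD addnn -mul2n exprM sqrrN !expr1n.
Qed.

Lemma rho_coef u rho :
  fundamental_cycle (@sple n) (proper_part (@sple n) (Pi_sp u)) (n%:Z - 2) rho ->
  rho (fchain u) * rho (fchain u) = 1.
Proof.
apply: fundamental_bchain; rewrite ?Pi_PiB ?bot_Pi ?top_Pi //.
- exact: split_le.
- exact: split_Pi.
- exact: card_tops_split.
Qed.

(** When the first group has at least two letters, the cut at 1 disappears before the cut at 0, so
    no special cut set occurs along the facet. *)
Lemma rhot_coef u rho : (0 < fend u)%N ->
  fundamental_cycle (@sple n) (proper_part (@sple n) (tPi_sp u)) (n%:Z - 2) rho ->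
  rho (fchain u) * rho (fchain u) = 1.
Proof.
move=> q0; have m0 : (0 < m)%N by rewrite -ltnS; exact: leq_ltn_trans q0 (ltn_ord _).
suff -> : fchain u = bchain (dsplit u) (crev u).
  apply: fundamental_bchain; rewrite ?tPi_PiB ?bot_tPi ?top_tPi //.
  - exact: dsplit_le.
  - exact: dsplit_tPi.
  - exact: card_tops_dsplit.
apply: eq_imset => j; rewrite /dsplit; case: ifP => //; rewrite -/(sset u j.+1) /dspecial.
have [jq|qj] := leqP j (fend u).
  rewrite !mem_sset //= val_pos1 // addn0 addn1 => /andP[h].
  by case/orP; [rewrite ltnNge q0|move/ltnW => h'; rewrite h' in h].
case/andP=> _; rewrite inE => h.
have /andP[_ h2] := grev_bounds (rl_max_last u) (pos1 m).
have [_ Bq _] := gendP (rl_max_last u) ord0.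
have h3 := gend_le (rl_max_last u) (p := pos1 m) Bq.
rewrite -/(cend u ord0) -/(fend u) val_pos1 // in h3.
by have := leq_trans h (leq_trans h2 (h3 q0)); rewrite ltnNge (ltnW qj).
Qed.

End Coefficients.

(** [nondegenerate] rules out n = 1 with T empty: both index sets are then empty, while the empty
    proper part has reduced homology of rank one in degree -1. *)
Theorem theorem9p1 (n : nat) (T : {set 'I_n})
    (nondegenerate : n = 1%N -> T != set0)
    (rho rhot : sperm n -> ochain (blocks n))
    (rhoP : forall u : sperm n,
       fundamental_cycle (@sple n) (proper_part (@sple n) (Pi_sp u))
         (n%:Z - 2) (rho u))
    (rhotP : forall u : sperm n, in_D u ->
       fundamental_cycle (@sple n) (proper_part (@sple n) (tPi_sp u))
         (n%:Z - 2) (rhot u)) :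
  homology_basis (@sple n) (proper_part (@sple n) (PiDB T)) (n%:Z - 2)
    (fun i : {u : sperm n | basisB T u} + {u : sperm n | basisD T u} =>
       match i with
       | inl u => rho (val u)
       | inr u => rhot (val u)
       end).
Proof.
case: n T nondegenerate rho rhot rhoP rhotP => [|m] T nd rho rhot rhoP rhotP.
  (* For n = 0 there is no first value, and a simplex of degree -2 would need -1 elements: both
     sides are empty. *)
  have noI : {u : sperm 0 | basisB T u} + {u : sperm 0 | basisD T u} -> False.
    case=> -[u]; first by case/andP=> /existsP[[]].
    by case/and3P=> _ /existsP[[]].
  split=> [i|c [cd _]|a _ i]; try by case: (noI i).
  exists (fun=> 0); exists 0; first by move=> C; rewrite ffunE eqxx.
  rewrite raddf0 big1 => [|i]; last by case: (noI i).
  rewrite subr0; apply/ffunP=> C; rewrite ffunE; apply/eqP; apply: contraT => /cd.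
  by case/and3P=> _ _ /eqP.
have nd0 : m = 0%N -> T != set0 by move=> E; apply: nd; rewrite E.
pose su (i : {u : sperm m.+1 | basisB T u} + {u : sperm m.+1 | basisD T u}) :=
  match i with inl u => val u | inr u => val u end.
have ruP i : rl_max_unbarred (su i).
  case: i => -[u uP] /=; move: uP; first by rewrite basisBP => /andP[].
  by rewrite basisDP => /and4P[].
have qD u : basisD T u -> (0 < fend u)%N /\ (0 < m)%N.
  rewrite basisDP => /and4P[_ _ ne _]; have q0 : (0 < fend u)%N.
    rewrite lt0n; apply: contraNneq ne => /(@ord_inj _ _ ord0) E.
    apply/eqP/ord_inj/eqP; rewrite eqn_leq -ltnS ltn_ord /= leqNgt; apply/negP=> lt.
    have := fend_max u ((u.1^-1)%g ord_max); rewrite E permKV /= leqNgt.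
    by rewrite lt.
  by split=> //; rewrite -ltnS; exact: leq_ltn_trans q0 (ltn_ord _).
have PiL := @PiDB_PiB m T; have botL := bot_PiDB T; have topL := top_PiDB nd0.
apply: (@homology_basis_triangular _ _ _ _ _ _ (fun i => fchain (su i)) (fun i => hgt (su i))).
- by move=> C; apply: no_simplex.
- case=> -[u uP] /=.
    have [/(_ tt) [zd zb] _ _] := rhoP u; split=> // C /zd.
    rewrite !simplex_mchain ?Pi_PiB ?bot_Pi ?top_Pi // => /andP[-> h].
    by apply: subset_trans h _; apply: Pi_sub; move: uP; rewrite basisBP => /andP[].
  have [q0 m0] := qD u uP; have uD : in_D u by move: uP; rewrite basisDP => /and4P[].
  have [/(_ tt) [zd zb] _ _] := rhotP u uD; split=> // C /zd.
  rewrite !simplex_mchain ?tPi_PiB ?bot_tPi ?top_tPi // => /andP[-> h].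
  by apply: subset_trans h _; exact: tPi_sub.
- case=> -[u uP] /=; first exact: rho_coef.
  have [q0 m0] := qD u uP; apply: rhot_coef => //; apply: rhotP.
  by move: uP; rewrite basisDP => /and4P[].
- move=> i j nz.
  (* The lattice of type D also contains splittings of the flipped word, so the sign at position 0
     cannot be compared. *)
  pose e := if i is inl _ then 0%N else 1%N.
  have sub k : (0 < k < m.+1)%N -> exists v S,
     [/\ chain_at (fchain (su j)) k = split_at v S, v.1 = (su i).1
       & forall p : 'I_m.+1, (e <= p)%N -> v.2 p = (su i).2 p].
    move=> hk; have [xC _] := at_in (fchain_mchain (su j)) hk.
    move: nz; rewrite /e {e}; case: i => -[u uP] /=.
      have [/(_ tt) [zd _] _ _] := rhoP u; move/zd.
      rewrite simplex_mchain ?Pi_PiB ?bot_Pi ?top_Pi // => /andP[_ /subsetP/(_ _ xC)].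
      by rewrite inE => /andP[_ /existsP[S /eqP->]]; exists u, S.
    have [q0 m0] := qD u uP; have uD : in_D u by move: uP; rewrite basisDP => /and4P[].
    have [/(_ tt) [zd _] _ _] := rhotP u uD; move/zd.
    rewrite simplex_mchain ?tPi_PiB ?bot_tPi ?top_tPi // => /andP[_ /subsetP/(_ _ xC)].
    rewrite inE => /andP[_ /existsP[S /andP[_ /orP[]/eqP->]]]; first by exists u, S.
    exists (flip_first u), S; split=> // p p1.
    by rewrite ffunE eqn0Ngt p1 addbF.
  have := hgt_le sub; rewrite leq_eqVlt => /orP[/eqP heq|]; last by right.
  left; have pp := perm_pos sub heq (ruP j) (ruP i).
  have E1 : (su i).1 = (su j).1 by apply/permP=> p; have [] := pp p.
  move: E1 pp {nz sub heq}; rewrite /e {e}.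
  case: i => -[u uP]; case: j => -[v vP] /= E1 pp.
  + congr inl; apply: val_inj => /=; rewrite [u]surjective_pairing [v]surjective_pairing E1.
    by congr pair; apply/ffunP=> p; have [_ ->] := pp p.
  + exfalso; move: uP vP; rewrite basisBP basisDP E1 => /andP[h _] /and4P[_ + _ _].
    by rewrite h.
  + exfalso; move: uP vP; rewrite basisBP basisDP E1 => /and4P[_ + _ _] /andP[h _].
    by rewrite h.
  congr inr; apply: val_inj => /=.
  (* All signs but the first agree; the even number of bars in both then fixes the first. *)
  have E2 (p : 'I_m.+1) : p != ord0 -> u.2 p = v.2 p.
    by rewrite -val_eqE /= -lt0n => p0; have [_ ->] := pp p.
  move: (uP) (vP); rewrite !basisDP => /and4P[uD _ _ _] /and4P[vD _ _ _].
  rewrite [u]surjective_pairing [v]surjective_pairing E1; congr pair.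
  apply/ffunP=> p; have [->|] := eqVneq p ord0; last exact: E2.
  move: uD vD; rewrite /in_D (cardsD1 ord0) [in X in _ -> X](cardsD1 ord0) !inE.
  have -> : [set i | u.2 i] :\ ord0 = [set i | v.2 i] :\ ord0.
    by apply/setP=> i; rewrite !inE; case: eqVneq => //= ne; exact: E2.
  by rewrite !oddD; case: (u.2 ord0); case: (v.2 ord0) => //=; case: odd.
move=> c cP van; apply/ffunP=> C; rewrite ffunE; apply: (cycle_zero nd0 cP).
  by move=> u uP; have := van (inl (Sub u uP)).
by move=> u uP; have := van (inr (Sub u uP)).
Qed.
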